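(* Let $r\ge2$ and $n\ge0$. There is a natural bijection between the set $L^{r,\mathrm{trop}}_n$ of tropical $(r,n)$-curves and the support $|\Sigma^r_n|$ of the fan $\Sigma^r_n$, under which, for every chain $\widetilde{\mathbf{I}}$, the subset $T_{\widetilde{\mathbf{I}}}\subseteq L^{r,\mathrm{trop}}_n$ corresponds to the cone $\sigma_{\widetilde{\mathbf{I}}}$.
   Context: $[n]=\{1,\ldots,n\}$, $\mathbb{Z}_r=\{0,\ldots,r-1\}$ with indices and negatives taken mod $r$, and $\zeta\in\mathbb{C}$ is a fixed primitive $r$th root of unity. Stable $(r,n)$-curves. An $r$-pinwheel curve of length $\ell\ge0$ is a connected nodal projective curve over $\mathbb{C}$ of arithmetic genus $0$ consisting of a central component $\cong\mathbb{P}^1$ and $r$ chains (''spokes'') of $\ell$ projective lines each, attached at one end to distinct points of the central component. An $(r,n)$-curve is a tuple $(C;\sigma;x^\pm,\{y^\ell\},\{z_i^j\})$ where $C$ is an $r$-pinwheel curve, $\sigma$ is an order-$r$ automorphism of $C$, and the following are smooth points of $C$: two distinct fixed points $x^+,x^-$ of $\sigma$ (lying on the central component); $n$ labeled light orbits $(z_i^0,\ldots,z_i^{r-1})$, $i\in[n]$, with $\sigma(z_i^j)=z_i^{j+1}$, where $z_i^j=z_{i'}^{j'}$ and $z_i^j=x^\pm$ are allowed; and a heavy orbit $(y^0,\ldots,y^{r-1})$ with $\sigma(y^\ell)=y^{\ell+1}$, whose elements are distinct from one another and from all $x^\pm$ and $z_i^j$. It is stable if, when there are spokes, the outermost component of each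 spoke contains exactly one of the points $y^\ell$, and every non-central component contains at least one light point. $\overline{\mathcal{L}}^r_n$ is the moduli space of those stable $(r,n)$-curves for which, in a coordinate $t$ on the central component with $x^-=0$, $x^+=\infty$, $\sigma$ acts by $t\mapsto\zeta t$. Tropical curves. The dual graph of an element of $\overline{\mathcal{L}}^r_n$ has a vertex for each irreducible component, an edge for each node, and a labeled half-edge for each marked point, attached to the vertex of the component containing it; $\sigma$ induces an automorphism $\sigma_\Gamma$ of the dual graph $\Gamma$. A tropical $(r,n)$-curve is a triple $(\Gamma,\sigma_\Gamma,L)$ (taken up to isomorphism preserving labels and lengths), where $\Gamma$ is the dual graph of an element of $\overline{\mathcal{L}}^r_n$, $\sigma_\Gamma$ is the induced automorphism, and $L:E(\Gamma)\to\mathbb{R}_{>0}$ satisfies $L(e)=L(\sigma_\Gamma(e))$ for all edges $e$. $L^{r,\mathrm{trop}}_n$ is the set of all tropical $(r,n)$-curves. Chains. A ($\mathbb{Z}_r$-decorated) chain of subsets of $[n]$ is a tuple $\widetilde{\mathbf{I}}=(I_1,\ldots,I_\ell,\mathfrak{a})$, $\ell\ge0$, with $\emptyset=I_0\subsetneq I_1\subsetneq\cdots\subsetneq I_\ell\subseteq[n]$ and $\mathfrak{a}:I_\ell\to\mathbb{Z}_r$. Type. A stable $(r,n)$-curve is of type $\widetilde{\mathbf{I}}$ if it has length $\ell$ and, writing $C^0_1,\ldots,C^0_\ell$ for the components of the spoke containing $y^0$, from outermost to innermost, the light points on $C^0_j$ are precisely $\{z_i^{\mathfrak{a}(i)}: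 i\in I_j\setminus I_{j-1}\}$ for each $j\in\{1,\ldots,\ell\}$, and the light points on the central component are precisely $\{z_i^k: i\in[n]\setminus I_\ell,\ k\in\mathbb{Z}_r\}$. Let $\Gamma_{\widetilde{\mathbf{I}}}$ be the dual graph of a curve of type $\widetilde{\mathbf{I}}$. Define $T_{\widetilde{\mathbf{I}}}$ to be the set of $(\Gamma,\sigma_\Gamma,L)\in L^{r,\mathrm{trop}}_n$ such that $\Gamma$ is obtained from $\Gamma_{\widetilde{\mathbf{I}}}$ by contracting (possibly no) edges. The fan. Let $V=(\mathbb{R}^r/\mathbb{R})^{\oplus n}$ (quotients by the diagonal), with $e_i^0,\ldots,e_i^{r-1}$ the images of the standard basis vectors in the $i$th summand. $\Sigma^r_n$ is the fan in $V$ with one cone $$\sigma_{\widetilde{\mathbf{I}}}=\operatorname{Cone}\Big\{\sum_{i\in I_1}e_i^{-\mathfrak{a}(i)},\ldots,\sum_{i\in I_\ell}e_i^{-\mathfrak{a}(i)}\Big\}$$ for each chain $\widetilde{\mathbf{I}}$, and $|\Sigma^r_n|$ is the union of these cones. *)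

(* Defs.v *)
From HB Require Import structures.
From mathcomp Require Import all_boot all_order all_fingroup all_algebra.
From mathcomp Require Import complex.
From mathcomp Require Import all_classical all_reals.

Set Implicit Arguments.
Unset Strict Implicit.
Unset Printing Implicit Defensive.

Import Order.TTheory GRing.Theory Num.Theory.
Local Open Scope ring_scope.

(* Throughout, R is the field of real numbers, R[i] the field of complex
   numbers, and 'Z_r is used with 1 < r only. *)

(* P^1 over the complex numbers; None is the point at infinity. *)
Definition P1 (R : realType) : Type := option R[i].

Definition mobius (R : realType) (a b c d : R[i]) (t : P1 R) : P1 R :=
  match t with
  | Some u => if c * u + d == 0 then None else Some ((a * u + b) / (c * u + d))
  | None => if c == 0 then None else Some (a / c)
  end.

Definition P1_automorphism (R : realType) (f : P1 R -> P1 R) : Prop :=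
  exists a b c d : R[i], a * d - b * c != 0 /\ f =1 mobius a b c d.

(* The components of an r-pinwheel curve of length l: None is the central
   component, and Some (s, j) is the j-th component of the spoke s, where j
   counts from 0 (the outermost component) to l - 1 (the innermost one). *)
Definition component (r l : nat) : finType := option ('I_r * 'I_l).

(* There is exactly one node on the inner side of each non-central component,
   so the nodes are indexed by these components. *)
Definition node (r l : nat) : finType := ('I_r * 'I_l)%type.

Definition inward (r l : nat) (e : node r l) : component r l :=
  omap (pair e.1) (insub e.2.+1).

(* The normalization of the curve is a disjoint union of projective lines. *)
Definition point (R : realType) (r l : nat) : Type :=
  (component r l * P1 R)%type.

(* The two points of the normalization lying over the node e: one on the
   component e itself (b = false), one on the next component towards the
   center (b = true). *)
Definition branch (R : realType) (r l : nat) (att : node r l -> bool -> P1 R)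
    (e : node r l) (b : bool) : point R r l :=
  (if b then inward e else Some e, att e b).

(* A nodal curve with rational components is given by its normalization
   together with the pairs of points that are glued into nodes. *)
Record pinwheel (R : realType) (r : nat) := Pinwheel {
  len : nat;
  att : node r len -> bool -> P1 R;
  att_inj : injective (fun eb : node r len * bool => branch att eb.1 eb.2)
}.

Definition cpoint (R : realType) (r : nat) (C : pinwheel R r) : Type :=
  point R r (len C).

Definition smooth (R : realType) (r : nat) (C : pinwheel R r) (p : cpoint C) :
    Prop :=
  forall e b, branch (@att _ _ C) e b <> p.

(* An automorphism of the curve is an automorphism of its normalization which
   permutes the pairs of points lying over the nodes. *)
Definition aut_act (R : realType) (r l : nat) (comp_map : {perm component r l})
    (line_map : component r l -> P1 R -> P1 R) (p : point R r l) :
    point R r l :=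
  (comp_map p.1, line_map p.1 p.2).

Record pinwheel_aut (R : realType) (r : nat) (C : pinwheel R r) := PinwheelAut {
  comp_map : {perm component r (len C)};
  node_map : {perm node r (len C)};
  line_map : component r (len C) -> P1 R -> P1 R;
  line_map_aut : forall v, P1_automorphism (line_map v);
  node_mapP : forall e,
    range (aut_act comp_map line_map \o branch (@att _ _ C) e)
    = range (branch (@att _ _ C) (node_map e))
}.

Definition act (R : realType) (r : nat) (C : pinwheel R r)
    (sigma : pinwheel_aut C) : cpoint C -> cpoint C :=
  aut_act (comp_map sigma) (line_map sigma).

Record rn_curve (R : realType) (r n : nat) := RnCurve {
  curve : pinwheel R r;
  sigma : pinwheel_aut curve;
  xplus : P1 R;
  xminus : P1 R;
  heavy : 'Z_r -> cpoint curve;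
  light : 'I_n -> 'Z_r -> cpoint curve;
  sigma_order : forall m, (forall p, iter m (act sigma) p = p) <-> (r %| m)%N;
  xplus_smooth : smooth (C := curve) (None, xplus);
  xminus_smooth : smooth (C := curve) (None, xminus);
  heavy_smooth : forall k, smooth (heavy k);
  light_smooth : forall i k, smooth (light i k);
  xplus_neq : xplus <> xminus;
  xplus_fixed : act sigma (None, xplus) = (None, xplus);
  xminus_fixed : act sigma (None, xminus) = (None, xminus);
  light_orbit : forall i k, act sigma (light i k) = light i (k + 1);
  heavy_orbit : forall k, act sigma (heavy k) = heavy (k + 1);
  heavy_inj : injective heavy;
  heavy_xplus : forall k, heavy k <> (None, xplus);
  heavy_xminus : forall k, heavy k <> (None, xminus);
  heavy_light : forall k i k', heavy k <> light i k'
}.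

Definition clen (R : realType) (r n : nat) (X : rn_curve R r n) : nat :=
  len (curve X).

Definition stable (R : realType) (r n : nat) (X : rn_curve R r n) : Prop :=
  (forall (s : 'I_r) (j : 'I_(clen X)), j = 0%N :> nat ->
     exists! k, (heavy X k).1 = Some (s, j)) /\
  (forall (s : 'I_r) (j : 'I_(clen X)),
     exists i k, (light X i k).1 = Some (s, j)).

Definition rotation_by (R : realType) (r n : nat) (zeta : R[i])
    (X : rn_curve R r n) : Prop :=
  exists t : P1 R -> P1 R,
    [/\ P1_automorphism t, t (xminus X) = Some 0, t (xplus X) = None
      & forall p, t (line_map (sigma X) None p) = omap ( *%R zeta) (t p)].

Definition in_Lbar (R : realType) (r n : nat) (zeta : R[i])
    (X : rn_curve R r n) : Prop :=
  stable X /\ rotation_by zeta X.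

Variant label (r n : nat) :=
  | Lplus
  | Lminus
  | Lheavy of 'Z_r
  | Llight of 'I_n & 'Z_r.
Arguments Lplus {r n}.
Arguments Lminus {r n}.
Arguments Lheavy {r n}.
Arguments Llight {r n}.

Definition next_label (r n : nat) (x : label r n) : label r n :=
  match x with
  | Lplus => Lplus
  | Lminus => Lminus
  | Lheavy k => Lheavy (k + 1)
  | Llight i k => Llight i (k + 1)
  end.

(* A loop is an edge whose set of endpoints is a singleton. *)
Record graph (r n : nat) := Graph {
  vert : finType;
  edge : finType;
  ends : edge -> {set vert};
  half_edge : label r n -> vert;
  ends_card : forall e, (0 < #|ends e| <= 2)%N
}.

Record graph_aut (r n : nat) (G : graph r n) := GraphAut {
  vert_map : {perm vert G};
  edge_map : {perm edge G};
  edge_mapP : forall e, ends (edge_map e) = vert_map @: ends e;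
  half_edge_mapP : forall x, half_edge G (next_label x) = vert_map (half_edge G x)
}.

Definition graph_iso (r n : nat) (G H : graph r n) (fv : vert G -> vert H)
    (fe : edge G -> edge H) : Prop :=
  [/\ bijective fv, bijective fe, forall e, ends (fe e) = fv @: ends e
    & forall x, half_edge H x = fv (half_edge G x)].

Definition graph_aut_iso (r n : nat) (G H : graph r n) (a : graph_aut G)
    (b : graph_aut H) (fv : vert G -> vert H) (fe : edge G -> edge H) : Prop :=
  [/\ graph_iso fv fe, forall v, fv (vert_map a v) = vert_map b (fv v)
    & forall e, fe (edge_map a e) = edge_map b (fe e)].

(* H is obtained from G by contracting edges: ge embeds the edges of H as the
   edges of G that are not contracted, and fv identifies the vertices of G that
   are connected by contracted edges. *)
Definition contraction (r n : nat) (G H : graph r n) : Prop :=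
  exists (fv : vert G -> vert H) (ge : edge H -> edge G),
    [/\ injective ge,
        forall v, exists u, fv u = v,
        forall u u', fv u = fv u' <->
          connect [rel x y | [exists e, [&& e \notin codom ge,
                                          x \in ends e & y \in ends e]]] u u',
        forall e, ends e = fv @: ends (ge e)
      & forall x, half_edge H x = fv (half_edge G x)].

Definition dual_ends (r l : nat) (e : node r l) : {set component r l} :=
  [set Some e; inward e].

Lemma dual_ends_card (r l : nat) (e : node r l) :
  (0 < #|dual_ends e| <= 2)%N.
Proof. by rewrite cards2; case: (_ != _). Qed.

Definition dual_half_edge (R : realType) (r n : nat) (X : rn_curve R r n)
    (x : label r n) : component r (clen X) :=
  match x with
  | Lplus | Lminus => None
  | Lheavy k => (heavy X k).1
  | Llight i k => (light X i k).1
  end.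

Definition dual (R : realType) (r n : nat) (X : rn_curve R r n) : graph r n :=
  Graph (@dual_half_edge R r n X) (@dual_ends_card r (clen X)).

Lemma dual_edge_mapP (R : realType) (r n : nat) (X : rn_curve R r n)
    (e : edge (dual X)) :
  ends (node_map (sigma X) e : edge (dual X))
  = comp_map (sigma X) @: (ends e : {set component r (clen X)}).
Proof.
rewrite /= /dual_ends imsetU1 imset_set1.
have H := node_mapP (sigma X) e.
have E b : exists b', aut_act (comp_map (sigma X)) (line_map (sigma X))
      (branch (@att _ _ (curve X)) e b)
    = branch (@att _ _ (curve X)) (node_map (sigma X) e) b'.
  have : range (branch (@att _ _ (curve X)) (node_map (sigma X) e))
      (aut_act (comp_map (sigma X)) (line_map (sigma X))
        (branch (@att _ _ (curve X)) e b)) by rewrite -H; exists b.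
  by case=> b' _ <-; exists b'.
have F b' : exists b, aut_act (comp_map (sigma X)) (line_map (sigma X))
      (branch (@att _ _ (curve X)) e b)
    = branch (@att _ _ (curve X)) (node_map (sigma X) e) b'.
  have : range (aut_act (comp_map (sigma X)) (line_map (sigma X))
      \o branch (@att _ _ (curve X)) e)
      (branch (@att _ _ (curve X)) (node_map (sigma X) e) b')
    by rewrite H; exists b'.
  by case=> b _ <-; exists b.
apply/setP=> v; rewrite !inE; apply/idP/idP.
  case/orP=> /eqP->.
    by have [[] [/= <- _]] := F false; rewrite eqxx ?orbT.
  by have [[] [/= <- _]] := F true; rewrite eqxx ?orbT.
case/orP=> /eqP->.
  by have [[] [/= -> _]] := E false; rewrite eqxx ?orbT.
by have [[] [/= -> _]] := E true; rewrite eqxx ?orbT.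
Qed.

Lemma dual_half_edge_mapP (R : realType) (r n : nat) (X : rn_curve R r n)
    (x : label r n) :
  half_edge (dual X) (next_label x)
  = comp_map (sigma X) (half_edge (dual X) x).
Proof.
case: x => [||k|i k] /=.
- by have [-> _] := xplus_fixed X.
- by have [-> _] := xplus_fixed X.
- by rewrite -heavy_orbit.
- by rewrite -light_orbit.
Qed.

Definition dual_aut (R : realType) (r n : nat) (X : rn_curve R r n) :
    graph_aut (dual X) :=
  GraphAut (@dual_edge_mapP R r n X) (@dual_half_edge_mapP R r n X).

Record tropical_curve (R : realType) (r n : nat) (zeta : R[i]) := TropicalCurve {
  tgraph : graph r n;
  tsigma : graph_aut tgraph;
  tlength : edge tgraph -> R;
  tlength_gt0 : forall e, 0 < tlength e;
  tlength_sigma : forall e, tlength e = tlength (edge_map tsigma e);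
  tdual : exists X : rn_curve R r n, in_Lbar zeta X /\
    exists fv fe, graph_aut_iso (dual_aut X) tsigma fv fe
}.

Definition tropical_iso (R : realType) (r n : nat) (zeta : R[i])
    (t t' : tropical_curve r n zeta) : Prop :=
  exists fv fe, graph_aut_iso (tsigma t) (tsigma t') fv fe /\
    forall e, tlength (fe e) = tlength e.

(* The type of isomorphism classes of tropical curves. A class is a bare
   predicate because [tropical_curve], which contains finTypes, is too large a
   type for the library's [set]. *)
Definition Ltrop (R : realType) (r n : nat) (zeta : R[i]) : Type :=
  {c : tropical_curve r n zeta -> Prop | exists t, c = tropical_iso t}.

Definition tropical_class (R : realType) (r n : nat) (zeta : R[i])
    (t : tropical_curve r n zeta) : Ltrop r n zeta :=
  exist _ (tropical_iso t) (ex_intro _ t erefl).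

Record chain (r n : nat) := Chain {
  chain_sets : seq {set 'I_n};
  chain_setsP :
    path [rel A B : {set 'I_n} | A \proper B] finset.set0 chain_sets;
  decoration : {i : 'I_n | i \in last finset.set0 chain_sets} -> 'Z_r
}.

Definition chain_length (r n : nat) (I : chain r n) : nat :=
  size (chain_sets I).

(* I_j, for 0 <= j <= chain_length I *)
Definition chain_set (r n : nat) (I : chain r n) (j : nat) : {set 'I_n} :=
  nth finset.set0 (finset.set0 :: chain_sets I) j.

Definition chain_top (r n : nat) (I : chain r n) : {set 'I_n} :=
  last finset.set0 (chain_sets I).

Definition has_type (R : realType) (r n : nat) (X : rn_curve R r n)
    (I : chain r n) : Prop :=
  [/\ clen X = chain_length I,
      forall (s : 'I_r), (exists j, (heavy X 0).1 = Some (s, j)) ->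
        forall (j : 'I_(clen X)) i k, (light X i k).1 = Some (s, j) <->
          i \in chain_set I j.+1 :\: chain_set I j /\
          exists2 u, val u = i & decoration (c := I) u = k
    & forall i k, (light X i k).1 = None <-> i \notin chain_top I].

Definition T_chain (R : realType) (r n : nat) (zeta : R[i]) (I : chain r n)
    (c : Ltrop r n zeta) : Prop :=
  exists (t : tropical_curve r n zeta) (X : rn_curve R r n),
    [/\ c = tropical_class t, in_Lbar zeta X, has_type X I
      & contraction (dual X) (tgraph t)].

Definition diagonal (R : realType) (r : nat) :
    {pred {ffun 'Z_r -> R^o}} :=
  fun x => [forall k, x k == x 0].

Lemma diagonal_zmod_closed (R : realType) (r : nat) :
  zmod_closed (@diagonal R r).
Proof.
split=> [|x y /forallP Dx /forallP Dy]; apply/forallP=> k; rewrite !ffunE //.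
by rewrite (eqP (Dx k)) (eqP (Dy k)).
Qed.

HB.instance Definition _ (R : realType) (r : nat) :=
  GRing.isZmodClosed.Build _ (@diagonal R r) (@diagonal_zmod_closed R r).

(* R^r / R *)
Definition diag_quot (R : realType) (r : nat) : Type :=
  Quotient.quot (@diagonal R r).

HB.instance Definition _ (R : realType) (r : nat) :=
  GRing.Zmodule.copy (diag_quot R r) (Quotient.quot (@diagonal R r)).

Section DiagQuotLmodule.
Variables (R : realType) (r : nat).
Local Notation Q := (Quotient.quot (@diagonal R r)).

Definition diag_proj (x : {ffun 'Z_r -> R^o}) : diag_quot R r := \pi_Q%qT x.

Definition diag_scale (a : R) (v : diag_quot R r) : diag_quot R r :=
  diag_proj (a *: (generic_quotient.repr (v : Q) : {ffun 'Z_r -> R^o})).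

Lemma diag_projP (x y : {ffun 'Z_r -> R^o}) :
  diag_proj x = diag_proj y <-> x - y \in @diagonal R r.
Proof.
have E := Quotient.idealrBE (@diagonal R r) x y.
by split=> [xy|]; [rewrite E; apply/eqP | rewrite E => /eqP].
Qed.

Lemma diag_projD (x y : {ffun 'Z_r -> R^o}) :
  diag_proj (x + y) = diag_proj x + diag_proj y.
Proof. exact: (raddfD \pi_Q%qT). Qed.

Lemma diag_proj_surj (v : diag_quot R r) : exists x, v = diag_proj x.
Proof. by exists (generic_quotient.repr (v : Q)); rewrite /diag_proj reprK. Qed.

Lemma diag_scaleE a (x : {ffun 'Z_r -> R^o}) :
  diag_scale a (diag_proj x) = diag_proj (a *: x).
Proof.
apply/diag_projP.
have /diag_projP/forallP D : diag_proj (generic_quotient.repr (diag_proj x : Q)) = diag_proj x.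
  by rewrite /diag_proj reprK.
apply/forallP=> k; move: (D k); rewrite !ffunE -!scalerBr => /eqP Dk.
by rewrite Dk.
Qed.

Lemma diag_scaleA a b v : diag_scale a (diag_scale b v) = diag_scale (a * b) v.
Proof. by have [x ->] := diag_proj_surj v; rewrite !diag_scaleE scalerA. Qed.

Lemma diag_scale1 : left_id 1 diag_scale.
Proof.
by move=> v; have [x ->] := diag_proj_surj v; rewrite diag_scaleE scale1r.
Qed.

Lemma diag_scaleDr : right_distributive diag_scale +%R.
Proof.
move=> a v w; have [x ->] := diag_proj_surj v; have [y ->] := diag_proj_surj w.
by rewrite -diag_projD !diag_scaleE scalerDr diag_projD.
Qed.

Lemma diag_scaleDl v : {morph diag_scale^~ v : a b / a + b}.
Proof.
move=> a b; have [x ->] := diag_proj_surj v.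
by rewrite !diag_scaleE scalerDl diag_projD.
Qed.

HB.instance Definition _ := GRing.Zmodule_isLmodule.Build R (diag_quot R r)
  diag_scaleA diag_scale1 diag_scaleDr diag_scaleDl.

End DiagQuotLmodule.

(* V = (R^r / R)^n *)
Notation fan_space R r n := {ffun 'I_n -> diag_quot R r}.

(* The vector e_i^k *)
Definition basis_vec (R : realType) (r n : nat) (i : 'I_n) (k : 'Z_r) :
    fan_space R r n :=
  [ffun i' => if i' == i then diag_proj [ffun k' => (k' == k)%:R : R^o] else 0].

(* The generator of the cone of I indexed by I_j *)
Definition cone_gen (R : realType) (r n : nat) (I : chain r n) (j : nat) :
    fan_space R r n :=
  \sum_(u : {i : 'I_n | i \in chain_top I} | val u \in chain_set I j)
    basis_vec R (val u) (- decoration (c := I) u).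
Arguments cone_gen R {r n} I j.

Definition cone (R : realType) (r n : nat) (I : chain r n) :
    set (fan_space R r n) :=
  [set v | exists c : 'I_(chain_length I) -> R, (forall j, 0 <= c j) /\
     v = \sum_j c j *: cone_gen R I j.+1]%classic.
Arguments cone R {r n} I.

Definition fan_support (R : realType) (r n : nat) : set (fan_space R r n) :=
  (\bigcup_(I in [set: chain r n]) cone R I)%classic.
Arguments fan_support R r n : clear implicits.

(* Main.v *)
(* Contracting every edge but one turns a tropical curve into an edge with two
   sides, so an edge e is determined by the set of labels which it cuts off from
   the center x^+, and these sets are preserved by contractions.  Let h(i, k) be
   the total length of the edges which cut off both y^0 and z_i^k: it vanishes
   except for the one value k = a(i) for which z_i^k lies on the spoke of y^0,
   where it is the distance of that light point from the center.  The bijection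
   sends a tropical curve to the vector with coordinates
   sum_k h(i, k) e_i^(-k).  As r >= 2, the function h can be recovered from its
   class modulo the diagonal, and it determines the sets of labels cut off by
   the edges (its superlevel sets) together with the lengths (the differences of
   its consecutive values), hence the curve. *)
Require Import Defs.
From mathcomp Require Import all_boot all_order all_fingroup all_algebra.
From mathcomp Require Import complex.
From mathcomp Require Import all_classical all_reals.
From mathcomp Require Import zify lra.

Set Implicit Arguments.
Unset Strict Implicit.
Unset Printing Implicit Defensive.

Import Order.TTheory GRing.Theory Num.Theory.

Local Open Scope ring_scope.

(** * Edge cuts and contractions *)

Section Sides.

Variables (r n : nat).
Implicit Types G H : graph r n.

(** Adjacency avoiding the edges in [K]. For [K] the surviving edges, its connected components are
    what a contraction collapses; for [K = pred1 e] they are the pieces left after deleting [e]. *)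
Definition link G (K : {pred edge G}) : rel (vert G) :=
  [rel x y | [exists e, [&& e \notin K, x \in ends e & y \in ends e]]].

(** The center is named through the label [Lplus], which contractions and isomorphisms respect, so
    that sides can be compared between graphs. *)
Definition side G (e : edge G) : {set vert G} :=
  [set v | ~~ connect (link (pred1 e)) v (half_edge G Lplus)].

(** The body of [contraction] with its two witnesses exposed. *)
Definition contracts G H (fv : vert G -> vert H) (ge : edge H -> edge G) :=
  [/\ injective ge,
      forall v, exists u, fv u = v,
      forall u u', fv u = fv u' <-> connect (link [in codom ge]) u u',
      forall e, ends e = fv @: ends (ge e)
    & forall x, half_edge H x = fv (half_edge G x)].

(** A path in [H] lifts edge by edge, the gaps inside the fibres of [fv] being filled by contracted
    edges, none of which is [ge e]. Conversely, along a path in [G] the contracted edges collapse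
    and the others descend. *)
Lemma connect_contract G H (fv : vert G -> vert H) (ge : edge H -> edge G) :
  injective ge ->
  (forall u u', fv u = fv u' <-> connect (link [in codom ge]) u u') ->
  (forall e, ends e = fv @: ends (ge e)) ->
  forall e u u', connect (link (pred1 e)) (fv u) (fv u')
    = connect (link (pred1 (ge e))) u u'.
Proof.
move=> ge_inj fib endsE e u u'; apply/idP/idP.
  case/connectP=> p.
  elim: p u => [|w p IH] u /=.
    move=> _ /esym/fib; apply: connect_sub => x y.
    case/existsP=> e' /and3P[e'K xe ye]; apply: connect1.
    apply/existsP; exists e'; rewrite xe ye !andbT inE.
    by apply: contraNneq e'K => ->; apply: codom_f.
  case/andP=> /existsP[e' /and3P[e'e]]; rewrite endsE.
  move=> /imsetP[a ae ua] /imsetP[b be wb]; rewrite wb => pb lastb.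
  have ua' : connect (link (pred1 (ge e))) u a.
    move/fib: ua; apply: connect_sub => x y.
    case/existsP=> e2 /and3P[e2K xe ye]; apply: connect1.
    apply/existsP; exists e2; rewrite xe ye !andbT inE.
    by apply: contraNneq e2K => ->; apply: codom_f.
  apply: connect_trans ua' (connect_trans (connect1 _) (IH b pb lastb)).
  apply/existsP; exists (ge e'); rewrite ae be !andbT inE.
  by move: e'e; rewrite inE; apply: contraNneq => /ge_inj->.
case/connectP=> p; elim: p u => [|w p IH] u /=; first by move=> _ ->.
case/andP=> /existsP[e' /and3P[e'e ue we]] pw lastw.
apply: connect_trans (IH w pw lastw).
have [/codomP[e2 e2E]|e'K] := boolP (e' \in codom ge).
  apply: connect1; apply/existsP; exists e2.
  rewrite !endsE -e2E !imset_f // !andbT.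
  by move: e'e; rewrite e2E !inE; apply: contraNneq => ->.
rewrite (_ : fv u = fv w) //; apply/fib/connect1/existsP.
by exists e'; rewrite e'K ue we.
Qed.

Lemma side_contracts G H (fv : vert G -> vert H) (ge : edge H -> edge G) :
  contracts fv ge -> forall e v, (fv v \in side e) = (v \in side (ge e)).
Proof.
by case=> gi _ fib ee he e v; rewrite !inE he (connect_contract gi fib ee).
Qed.

(** Here [ge] is onto, so the link relation is empty: an isomorphism is a contraction of no
    edges. *)
Lemma link_codom_bij G H (fv : vert G -> vert H) (ge : edge H -> edge G) fe :
  injective fv -> cancel fe ge ->
  forall u u', fv u = fv u' <-> connect (link [in codom ge]) u u'.
Proof.
move=> fvi feK u u'; split=> [/fvi->//|].
case/connectP=> [[|w p] /= + ->] // => /andP[/existsP[e /and3P[]]].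
by case/codomP; exists (fe e); rewrite feK.
Qed.

Lemma side_bij G H (fv : vert G -> vert H) (fe : edge G -> edge H) :
  injective fv -> bijective fe -> (forall e, ends (fe e) = fv @: ends e) ->
  half_edge H Lplus = fv (half_edge G Lplus) ->
  forall e v, (fv v \in side (fe e)) = (v \in side e).
Proof.
move=> fvi [ge feK geK] ee hp e v; rewrite !inE hp.
rewrite (@connect_contract _ _ fv ge) ?feK //; first exact: can_inj geK.
  exact: link_codom_bij fvi feK.
by move=> e'; rewrite -ee geK.
Qed.

Lemma graph_iso_contracts G H (fv : vert G -> vert H) (fe : edge G -> edge H) :
  graph_iso fv fe ->
  exists ge, [/\ cancel fe ge, cancel ge fe & contracts fv ge].
Proof.
case=> fvb [ge feK geK] ee he; exists ge; split=> //; split=> //.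
- exact: can_inj geK.
- by case: fvb => gv _ gvK v; exists (gv v).
- exact: link_codom_bij (bij_inj fvb) feK.
- by move=> e; rewrite -ee geK.
Qed.

Lemma contracts_graph_iso G H (fv : vert G -> vert H) (ge : edge H -> edge G)
    fe :
  contracts fv ge -> cancel fe ge -> cancel ge fe -> graph_iso fv fe.
Proof.
case=> gi surj fib ee he feK geK; split=> //.
- apply: inj_card_bij.
    move=> u u' /fib /connectP[[|w p] /= + ->] // => /andP[/existsP[e /and3P[]]].
    by case/codomP; exists (fe e); rewrite feK.
  (* A section of the surjection [fv] is injective, which bounds the number of vertices of [H] by
     that of [G]. *)
  have /boolp.choice [gv gvK] := surj.
  exact: leq_card (can_inj gvK).
- by exists ge.
- by move=> e; rewrite ee feK.
Qed.

Lemma graph_iso_sym G H (fv : vert G -> vert H) (fe : edge G -> edge H) gv ge :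
  cancel fv gv -> cancel gv fv -> cancel fe ge -> cancel ge fe ->
  graph_iso fv fe -> graph_iso gv ge.
Proof.
move=> fvK gvK feK geK [_ _ ee he]; split; [by exists fv|by exists fe| |].
- move=> e; rewrite -{2}[e]geK ee -imset_comp.
  by rewrite (eq_imset _ (fvK : _ \o _ =1 id)) imset_id.
- by move=> x; rewrite he fvK.
Qed.

Lemma graph_iso_comp G H K (fv : vert G -> vert H) (fe : edge G -> edge H)
    (gv : vert H -> vert K) (ge : edge H -> edge K) :
  graph_iso fv fe -> graph_iso gv ge -> graph_iso (gv \o fv) (ge \o fe).
Proof.
case=> b1 b2 ee he [b3 b4 ee' he']; split; try exact: bij_comp.
- by move=> e /=; rewrite ee' ee -imset_comp.
- by move=> x /=; rewrite he' he.
Qed.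

Lemma graph_aut_iso_sym G H (a : graph_aut G) (b : graph_aut H) fv fe gv ge :
  cancel fv gv -> cancel gv fv -> cancel fe ge -> cancel ge fe ->
  graph_aut_iso a b fv fe -> graph_aut_iso b a gv ge.
Proof.
move=> fvK gvK feK geK [i ev ee]; split; first exact: graph_iso_sym i.
  by move=> v; apply: (can_inj fvK); rewrite ev !gvK.
by move=> e; apply: (can_inj feK); rewrite ee !geK.
Qed.

Lemma graph_aut_iso_comp G H K (a : graph_aut G) (b : graph_aut H)
    (c : graph_aut K) fv fe gv ge :
  graph_aut_iso a b fv fe -> graph_aut_iso b c gv ge ->
  graph_aut_iso a c (gv \o fv) (ge \o fe).
Proof.
case=> i ev ee [i' ev' ee']; split; first exact: graph_iso_comp i i'.
  by move=> v /=; rewrite ev ev'.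
by move=> e /=; rewrite ee ee'.
Qed.

End Sides.

(** * Isomorphism of tropical curves is an equivalence *)

Section TropicalIso.

Variables (R : realType) (r n : nat) (zeta : R[i]).
Implicit Types t : tropical_curve r n zeta.

Lemma tropical_iso_sym t t' : tropical_iso t t' -> tropical_iso t' t.
Proof.
case=> fv [fe [a_iso lenE]]; have [[bv be _ _] _ _] := a_iso.
have [gv fvK gvK] := bv; have [ge feK geK] := be; exists gv, ge; split.
  exact: graph_aut_iso_sym a_iso.
by move=> e; rewrite -lenE geK.
Qed.

Lemma tropical_iso_trans t t' t'' :
  tropical_iso t t' -> tropical_iso t' t'' -> tropical_iso t t''.
Proof.
case=> fv [fe [a lenE]] [fv' [fe' [a' lenE']]].
exists (fv' \o fv), (fe' \o fe); split; first exact: graph_aut_iso_comp a a'.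
by move=> e /=; rewrite lenE'.
Qed.

Lemma tropical_class_eq t t' :
  tropical_iso t t' -> tropical_class t = tropical_class t'.
Proof.
move=> tt'; rewrite /tropical_class.
have E : tropical_iso t = tropical_iso t'.
  apply/funext=> u; apply/propext; split; last exact: tropical_iso_trans.
  exact: tropical_iso_trans (tropical_iso_sym tt').
by apply: eq_exist.
Qed.

End TropicalIso.

(** * Dual graphs of pinwheel curves *)

Section Outer.

Variables (r l : nat).
Implicit Types (e : node r l) (v : component r l).

(** The explicit form of [side] in a dual graph: levels count from the outside, and the node [e] is
    on the inner side of the component [e], which is therefore cut off as well. *)
Definition outer e : {set component r l} :=
  [set v : component r l |
    if v is Some e' then (e'.1 == e.1) && (e'.2 <= e.2)%N else false].

Lemma None_outer e : (None \in outer e) = false.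
Proof. by rewrite inE. Qed.

Lemma Some_outer e e' : (Some e' \in outer e) = (e'.1 == e.1) && (e'.2 <= e.2)%N.
Proof. by rewrite inE. Qed.

Lemma node_eqE e e' : (e == e') = (e.1 == e'.1) && (e.2 == e'.2 :> nat).
Proof. by case: e e' => [s j] [s' j']. Qed.

Lemma inward_outer e e' :
  (inward e' \in outer e) = (Some e' \in outer e) && (e != e').
Proof.
rewrite Some_outer node_eqE /inward inE; case: insubP => [j _ /= ->|jl] /=.
  by rewrite [e.1 == _]eq_sym; case: eqP => //= _; lia.
(* Here [inward e'] is the center, so [e'] is innermost and only [e = e'] has a level at least as
   large on this spoke. *)
rewrite [e.1 == _]eq_sym; case: eqP => //= _.
by case: e e' jl => [s j] [s' j'] /=; have := ltn_ord j; lia.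
Qed.

Lemma dual_ends_outer e e' x y : e' != e ->
  x \in dual_ends e' -> y \in dual_ends e' -> (x \in outer e) = (y \in outer e).
Proof.
move=> ne; suff E z : z \in dual_ends e' -> (z \in outer e) = (Some e' \in outer e).
  by move=> /E-> /E->.
by rewrite in_set2 => /orP[] /eqP-> //; rewrite inward_outer eq_sym ne andbT.
Qed.

Lemma outer_trans e e' v : Some e \in outer e' -> v \in outer e -> v \in outer e'.
Proof.
rewrite Some_outer => /andP[/eqP e1 e2]; case: v => [v|]; last by rewrite !inE.
by rewrite !Some_outer e1 => /andP[-> /leq_trans->].
Qed.

Lemma outer_refl e : Some e \in outer e.
Proof. by rewrite Some_outer eqxx leqnn. Qed.

Lemma outer_anti e e' : Some e \in outer e' -> Some e' \in outer e -> e = e'.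
Proof.
rewrite !Some_outer => /andP[/eqP e1 le1] /andP[_ le2].
by apply/eqP; rewrite node_eqE e1 eqxx eqn_leq le1.
Qed.

(** The sets [outer e] order each spoke, so antisymmetry determines a non-central component; the
    center is the one vertex lying in none of them. *)
Lemma component_ext v v' :
  (forall e, (v \in outer e) = (v' \in outer e)) -> v = v'.
Proof.
case: v v' => [e|] [e'|] // E.
- by congr Some; apply: outer_anti; rewrite ?E ?outer_refl // -E outer_refl.
- by have := E e; rewrite outer_refl None_outer.
- by have := E e'; rewrite outer_refl None_outer.
Qed.

Lemma outer_ext e e' :
  (forall v, (v \in outer e) = (v \in outer e')) -> e = e'.
Proof. by move=> E; apply: outer_anti; rewrite -?E ?outer_refl // E outer_refl. Qed.

(** The set [outer e] separates the ends of [e] but not those of any other node. Hence a map of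
    vertices determines the map of edges. *)
Lemma dual_ends_inj : injective (@dual_ends r l).
Proof.
move=> e e' ee'; apply/eqP; case: eqVneq => // ne.
have := dual_ends_outer ne (set21 _ _ : Some e \in dual_ends e)
  (set22 _ _ : inward e \in dual_ends e).
have := dual_ends_outer (e := e) (e' := e'); rewrite eq_sym => /(_ _ _ ne).
rewrite -ee' => /(_ _ _ (set21 _ _) (set22 _ _)).
by rewrite outer_refl inward_outer eqxx andbF.
Qed.

(** Turns the level of a node into a cardinality, which bijections preserve. *)
Lemma card_outer e : #|outer e| = e.2.+1.
Proof.
case: e => s j; have lj : (j < l)%N := ltn_ord j.
have -> : outer (s, j) = [set Some (s, widen_ord lj i) | i : 'I_j.+1].
  apply/setP=> v; rewrite inE; apply/idP/imsetP => [|[i _ ->] /=]; last first.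
    by rewrite eqxx -ltnS ltn_ord.
  case: v => // -[s' j'] /andP[/= /eqP-> le_j].
  exists (Ordinal (le_j : j' < j.+1)%N) => //.
  by congr (Some (_, _)); apply: val_inj.
by rewrite card_imset ?card_ord // => i i' [] ii'; apply: val_inj.
Qed.

(** A normal form for vertices up to links outside [K]: walk inwards and stop at the first component
    whose node is in [K], or at the center. The induction is on the distance [l - j] from the
    center. *)
Lemma walk_inward (K : {pred node r l}) v :
  exists2 w, connect [rel x y | [exists e,
      [&& e \notin K, x \in dual_ends e & y \in dual_ends e]]] v w
    & if w is Some e then e \in K else true.
Proof.
case: v => [[s j]|]; last by exists None.
have [k] := ubnP (l - j)%N; elim: k j => // k IH j kl.
have [eK|eK] := boolP ((s, j) \in K); first by exists (Some (s, j)).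
have c1 : connect [rel x y | [exists e,
    [&& e \notin K, x \in dual_ends e & y \in dual_ends e]]]
    (Some (s, j)) (inward (s, j)).
  by apply/connect1/existsP; exists (s, j); rewrite eK set21 set22.
move: c1; rewrite /inward; case: insubP => [j' _ /= jE|_] /= c1.
  case: (IH j'); first by have := ltn_ord j; lia.
  by move=> w c2 wK; exists w => //; exact: connect_trans c1 c2.
by exists None.
Qed.

End Outer.

Section DualGraph.

Variables (R : realType) (r n : nat).
Implicit Types X : rn_curve R r n.

Lemma connect_outer X (K : {pred node r (clen X)}) e u v : e \in K ->
  connect (link (G := dual X) K) u v -> (u \in outer e) = (v \in outer e).
Proof.
move=> eK /connectP[p]; elim: p u => [|w p IH] u /=; first by move=> _ ->.
case/andP=> /existsP[e' /and3P[e'K ue we]] pw /(IH _ pw) <-.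
by apply: dual_ends_outer ue we; apply: contraNneq e'K => ->.
Qed.

(** Links other than [e] never leave [outer e], so no vertex there reaches the center. From any
    vertex, walking inwards until [e] ends either at the center or at the component [e], and the
    latter happens only inside [outer e]. *)
Lemma side_dual X (e : node r (clen X)) : side (e : edge (dual X)) = outer e.
Proof.
apply/setP=> v; rewrite inE /=.
have ee : e \in pred1 e by rewrite inE.
apply/negP/idP => [nc|ve c]; last first.
  by move: ve; rewrite (connect_outer ee c) None_outer.
have [[e'|] cw /= wK] := walk_inward (pred1 e) v; last by case: nc.
move: wK; rewrite inE => /eqP e'E; move: cw; rewrite e'E => cw.
by rewrite (connect_outer (X := X) ee cw) outer_refl.
Qed.
End DualGraph.

(** * Labels, spokes and the rotation on a stable curve *)

Section StableCurves.

Variables (R : realType) (r n : nat).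
Hypothesis hr : (1 < r)%N.
Implicit Types X : rn_curve R r n.

Lemma iter_next_heavy p k :
  iter p (@next_label r n) (Lheavy k) = Lheavy (k + p%:R).
Proof. by elim: p => [|p IH]; rewrite ?addr0 //= IH /= -natr1 addrA. Qed.

Lemma iter_next_light p i k :
  iter p (@next_label r n) (Llight i k) = Llight i (k + p%:R).
Proof. by elim: p => [|p IH]; rewrite ?addr0 //= IH /= -natr1 addrA. Qed.

(** Stability puts a light point on each non-central component, and the center carries [Lplus].
    Vertex maps can therefore be defined and compared on labels. *)
Lemma stable_labelled X (v : component r (clen X)) : stable X ->
  exists x, dual_half_edge X x = v.
Proof.
case=> _ lights; case: v => [[s j]|]; last by exists Lplus.
by have [i [k E]] := lights s j; exists (Llight i k).
Qed.

(** Each outermost component carries exactly one heavy point, and as there are as many spokes as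
    heavy points this matches them bijectively. Every [outer e] contains the outermost component of
    its spoke. *)
Lemma heavy_outer X : stable X ->
  exists hs : 'I_r -> 'Z_r, bijective hs /\
    forall e m, ((heavy X m).1 \in outer e) = (hs e.1 == m).
Proof.
case=> heavies _; have card_r : #|'Z_r| = #|'I_r| by rewrite !card_ord Zp_cast.
case: (posnP (clen X)) => [l0|l_gt0].
  (* Without nodes the second condition is void and any bijection will do. *)
  exists (cast_ord (esym (Zp_cast hr))); split.
    by apply: inj_card_bij => [|]; [exact: cast_ord_inj|rewrite card_r].
  by case=> s j; have := ltn_ord j; rewrite [X in (_ < X)%N]l0.
pose j0 := Ordinal l_gt0.
have /boolp.choice [hs hsE] : forall s, exists k, (heavy X k).1 = Some (s, j0) /\
    forall k', (heavy X k').1 = Some (s, j0) -> k = k'.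
  by move=> s; have [k [? ?]] := heavies s j0 erefl; exists k.
have hs_inj : injective hs.
  move=> s s' ss'; have [E _] := hsE s; have [E' _] := hsE s'.
  by move: E'; rewrite -ss' E => -[].
have hs_bij : bijective hs by apply: inj_card_bij; rewrite ?card_r.
exists hs; split=> // e m; have [hs' hsK hsK'] := hs_bij.
rewrite -{1}[m]hsK'; have [-> _] := hsE (hs' m).
by rewrite Some_outer /= andbT -(inj_eq hs_inj) hsK' eq_sym.
Qed.

Lemma comp_map_outer X (e : node r (clen X)) v :
  (comp_map (sigma X) v \in outer (node_map (sigma X) e)) = (v \in outer e).
Proof.
rewrite -!(side_dual (X := X)).
apply: (@side_bij _ _ (dual X) (dual X) (vert_map (dual_aut X))
  (edge_map (dual_aut X))).
- exact: perm_inj.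
- exact: Bijective (permK _) (permKV _).
- exact: edge_mapP.
- exact: (half_edge_mapP (dual_aut X) Lplus).
Qed.

Lemma iter_label_outer X (e : node r (clen X)) x p :
  (dual_half_edge X (iter p (@next_label r n) x)
    \in outer (iter p (node_map (sigma X)) e))
  = (dual_half_edge X x \in outer e).
Proof.
elim: p => //= p IH; rewrite -IH -[RHS]comp_map_outer.
by have := half_edge_mapP (dual_aut X) (iter p (@next_label r n) x) => /= ->.
Qed.

(** The rotation maps [outer e] bijectively onto the set cut off by the image node, and the
    cardinality records the level. *)
Lemma node_map_level X (e : node r (clen X)) : (node_map (sigma X) e).2 = e.2.
Proof.
have : #|outer (node_map (sigma X) e)| = #|outer e|.
  rewrite -(card_imset (outer e) (@perm_inj _ (comp_map (sigma X)))).
  apply: eq_card => v.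
  rewrite -[v](permKV (comp_map (sigma X))) comp_map_outer.
  by rewrite mem_imset //; exact: perm_inj.
by rewrite !card_outer => -[] /val_inj.
Qed.

(** The power [hs s' - hs s] of the rotation carries the heavy point of the spoke [s] to that of
    [s'], hence one spoke to the other, and levels are kept. *)
Lemma node_map_transitive X (s s' : 'I_r) (j : 'I_(clen X)) : stable X ->
  exists p, iter p (node_map (sigma X)) (s, j) = (s', j).
Proof.
move=> /heavy_outer [hs [hs_bij hsE]].
pose p : nat := (hs s' - hs s)%R; exists p.
set e' := iter _ _ _.
have e'2 : e'.2 = j by rewrite /e'; elim: (p) => //= q IH; rewrite node_map_level.
have := iter_label_outer (s, j) (Lheavy (hs s)) p.
rewrite iter_next_heavy /= !hsE eqxx /p natr_Zp [hs s + _]addrC subrK.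
move=> /eqP/(bij_inj hs_bij).
by rewrite /= -/e' -e'2 => <-; case: (e').
Qed.

Lemma node_map_inv X (T : Type) (L : node r (clen X) -> T) s s' j : stable X ->
  (forall e, L (node_map (sigma X) e) = L e) -> L (s, j) = L (s', j).
Proof.
move=> st Linv; have [p <-] := node_map_transitive s s' j st.
by elim: p => //= p ->; rewrite Linv.
Qed.

(** The power [k' - k] of the rotation takes the first light point to the second and shifts heavy
    labels by [k' - k]. If both light points share the spoke of [y^0], that spoke is mapped to
    itself, so the shift is 0. *)
Lemma light_spoke_inj X i k k' (e e' : node r (clen X)) : stable X ->
  (heavy X 0).1 \in outer e -> (light X i k).1 \in outer e ->
  (heavy X 0).1 \in outer e' -> (light X i k').1 \in outer e' -> k = k'.
Proof.
move=> /heavy_outer [hs [hs_bij hsE]].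
pose p : nat := (k' - k)%R.
have := iter_label_outer e (Lheavy 0) p; have := iter_label_outer e (Llight i k) p.
rewrite iter_next_heavy iter_next_light /= natr_Zp [k + _]addrC subrK add0r => <- <-.
move: (iter _ _ _) => e1; rewrite !hsE => /eqP e1p l1 /eqP e'0 l2.
suff e1e' : e1.1 = e'.1 by apply/eqP; rewrite eq_sym -subr_eq0 -e1p e1e' e'0.
move: l1 l2; case: (light X i k').1 => [e2|]; last by rewrite None_outer.
by rewrite !Some_outer => /andP[/eqP<- _] /andP[/eqP<- _].
Qed.

(** Every vertex carries a label, and on labels both automorphisms act by [next_label]; an edge is
    determined by its ends. *)
Lemma dual_iso_equivariant X X' (fv : vert (dual X) -> vert (dual X'))
    (fe : edge (dual X) -> edge (dual X')) :
  stable X -> graph_iso fv fe ->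
  graph_aut_iso (dual_aut X) (dual_aut X') fv fe.
Proof.
move=> st iso; have [bv be ee he] := iso.
have eqv v : fv (vert_map (dual_aut X) v) = vert_map (dual_aut X') (fv v).
  have [x <-] := stable_labelled v st.
  have := half_edge_mapP (dual_aut X) x => /= <-.
  exact: etrans (esym (he _)) (etrans (half_edge_mapP (dual_aut X') x) (congr1 _ (he x))).
split=> // e; apply: dual_ends_inj.
rewrite -[LHS]/(ends (fe (edge_map (dual_aut X) e))) ee edge_mapP.
rewrite -[RHS]/(ends (edge_map (dual_aut X') (fe e))) edge_mapP ee.
by rewrite -!imset_comp; apply: eq_imset.
Qed.

(* A family of edges of dual X cutting the labels in the same way as the edges
   of dual X' exhibits dual X' as a contraction of dual X: a vertex is
   determined by the edges separating it from the center. *)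
Lemma contracts_of_labels X X' (ge : node r (clen X') -> node r (clen X)) :
  stable X -> stable X' ->
  (forall e x, (dual_half_edge X' x \in outer e)
    = (dual_half_edge X x \in outer (ge e))) ->
  exists fv, contracts (G := dual X) (H := dual X') fv ge.
Proof.
move=> st st' geE.
have /boolp.choice [lab labE] : forall v, exists x, dual_half_edge X x = v.
  by move=> v; apply: stable_labelled.
(* The choice of label is immaterial: by [fvE] the image is determined by the nodes that separate it
   from the center. *)
pose fv v := dual_half_edge X' (lab v).
have fvE e v : (fv v \in outer e) = (v \in outer (ge e)) by rewrite geE labE.
have he x : dual_half_edge X' x = fv (dual_half_edge X x).
  by apply: component_ext => e; rewrite fvE geE.
have surj v : exists u, fv u = v.
  by have [x <-] := stable_labelled v st'; exists (dual_half_edge X x).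
have gi : injective ge.
  move=> e e' E; apply: outer_ext => v.
  by have [u <-] := surj v; rewrite !fvE E.
have le_ge e e' : (Some (ge e) \in outer (ge e')) = (Some e \in outer e').
  apply/idP/idP => ee'.
    have [u uE] := surj (Some e); rewrite -uE fvE.
    by apply: outer_trans ee' _; rewrite -fvE uE outer_refl.
  have [x xE] := stable_labelled (Some (ge e)) st.
  by rewrite -xE -geE; apply: outer_trans ee' _; rewrite geE xE outer_refl.
exists fv; split=> // [u u'|e]; last first.
  rewrite [RHS](_ : _ = fv @: [set Some (ge e); inward (ge e)]) //.
  rewrite imsetU1 imset_set1; congr [set _; _].
    by apply: component_ext => e'; rewrite fvE le_ge.
  by apply: component_ext => e'; rewrite fvE !inward_outer le_ge (inj_eq gi).
split=> [uu'|c]; last first.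
  apply: component_ext => e; rewrite !fvE.
  by apply: connect_outer c; apply: codom_f.
have sep e : (u \in outer (ge e)) = (u' \in outer (ge e)) by rewrite -!fvE uu'.
(* Both vertices are walked inwards through contracted nodes to a surviving node or the center;
   there, lying on the same sides of all surviving nodes forces equality. *)
have [w cw wK] := walk_inward [in codom ge] u.
have [w' cw' w'K] := walk_inward [in codom ge] u'.
suff ww' : w = w'.
  apply: connect_trans cw _; rewrite ww'.
  have sym : symmetric (link (G := dual X) [in codom ge]).
    by move=> x y; apply: eq_existsb => e /=; rewrite [X in _ && X]andbC.
  by rewrite (sym_connect_sym sym).
have uw e : e \in codom ge -> (u \in outer e) = (w \in outer e).
  by move=> eK; apply: connect_outer cw.
have uw' e : e \in codom ge -> (u' \in outer e) = (w' \in outer e).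
  by move=> eK; apply: connect_outer cw'.
have ww' e : e \in codom ge -> (w \in outer e) = (w' \in outer e).
  by move=> eK; rewrite -uw // -uw' //; case/codomP: eK => e0 ->.
case: w w' wK w'K ww' {cw cw' uw uw'} => [e|] [e'|] //= eK e'K ww'.
- by congr Some; apply: outer_anti; [rewrite ww'//|rewrite -ww'//]; rewrite outer_refl.
- by have := ww' e eK; rewrite outer_refl None_outer.
- by have := ww' e' e'K; rewrite outer_refl None_outer.
Qed.

End StableCurves.

(** * Heights *)

Section Heights.

Variables (R : realType) (r n : nat).

(* The distance from the center at which the paths to the heavy point m and to
   the light point (i, k) separate. *)
Definition height (G : graph r n) (L : edge G -> R) (m : 'Z_r) (i : 'I_n)
    (k : 'Z_r) : R :=
  \sum_(e | (half_edge G (Lheavy m) \in side e)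
            && (half_edge G (Llight i k) \in side e)) L e.

(** Only [y^0] enters. The negated index matches the vectors e_i^(-a(i)) that generate the cones. *)
Definition height_vec (G : graph r n) (L : edge G -> R) : fan_space R r n :=
  [ffun i => diag_proj [ffun k => height L 0 i (- k) : R^o]].

Lemma height_contracts (G H : graph r n) (fv : vert G -> vert H)
    (ge : edge H -> edge G) (L : edge H -> R) m i k :
  contracts fv ge ->
  height L m i k = \sum_(e | (half_edge G (Lheavy m) \in side (ge e))
            && (half_edge G (Llight i k) \in side (ge e))) L e.
Proof.
move=> c; have [_ _ _ _ he] := c; apply: eq_bigl => e.
by rewrite !he !(side_contracts c).
Qed.

Lemma height_iso (G H : graph r n) (fv : vert G -> vert H)
    (fe : edge G -> edge H) (L : edge H -> R) m i k :
  graph_iso fv fe -> height L m i k = height (L \o fe) m i k.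
Proof.
move=> /graph_iso_contracts [ge [feK geK c]].
rewrite (height_contracts _ _ _ _ c).
rewrite (reindex fe) /=; last by exists ge => ? _.
by apply: eq_bigl => e; rewrite feK.
Qed.

Lemma height_vec_iso (G H : graph r n) (fv : vert G -> vert H)
    (fe : edge G -> edge H) (L : edge H -> R) :
  graph_iso fv fe -> height_vec L = height_vec (L \o fe).
Proof.
move=> iso; apply/ffunP=> i; rewrite !ffunE; congr diag_proj.
by apply/ffunP=> k; rewrite !ffunE (height_iso _ _ _ _ iso).
Qed.

Lemma eq_height_vec (G : graph r n) (L L' : edge G -> R) :
  L =1 L' -> height_vec L = height_vec L'.
Proof.
move=> LL'; apply/ffunP=> i; rewrite !ffunE; congr diag_proj.
by apply/ffunP=> k; rewrite !ffunE; apply: eq_bigr.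
Qed.

(** The automorphism permutes the summands. This recovers the heights for every heavy point from
    those for [y^0]. *)
Lemma height_shift (G : graph r n) (a : graph_aut G) (L : edge G -> R) m i k p :
  (forall e, L (edge_map a e) = L e) ->
  height L (m + p%:R) i (k + p%:R) = height L m i k.
Proof.
move=> La; elim: p => [|p IH]; first by rewrite !addr0.
rewrite -IH -natr1 !addrA /height (reindex_inj (@perm_inj _ (edge_map a))).
apply: eq_big => // e.
have sideE v : (vert_map a v \in side (edge_map a e)) = (v \in side e).
  apply: side_bij; [exact: perm_inj|exact: Bijective (permK _) (permKV _)| |].
    exact: edge_mapP.
  exact: (half_edge_mapP a Lplus).
have /= -> := half_edge_mapP a (Lheavy (m + p%:R)).
by have /= -> := half_edge_mapP a (Llight i (k + p%:R)); rewrite !sideE.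
Qed.

Lemma height_dual (X : rn_curve R r n) (L : node r (clen X) -> R) m i k :
  height (G := dual X) L m i k
  = \sum_(e | ((heavy X m).1 \in outer e) && ((light X i k).1 \in outer e)) L e.
Proof. by apply: eq_bigl => e; rewrite !side_dual. Qed.

(** The difference of the two functions is a constant. If it were nonzero, one of them would be
    positive everywhere, in particular at the distinct elements 0 and 1 of ['Z_r], while each is
    nonzero at most once. *)
Lemma diag_proj_inj_ge0 (g g' : 'Z_r -> R) :
  (forall k, 0 <= g k) -> (forall k, 0 <= g' k) ->
  (forall k k', g k != 0 -> g k' != 0 -> k = k') ->
  (forall k k', g' k != 0 -> g' k' != 0 -> k = k') ->
  diag_proj [ffun k => g (- k) : R^o] = diag_proj [ffun k => g' (- k) : R^o] ->
  g =1 g'.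
Proof.
move=> g0 g'0 gu g'u /diag_projP/forallP D.
pose c := g 0 - g' 0.
have {}D k : g k - g' k = c by have /eqP := D (- k); rewrite !ffunE opprK oppr0.
have one : 1 <> 0 :> 'Z_r by apply/eqP; exact: oner_neq0.
case: (ltrgtP c 0) => [c0|c0|c0] k; last by apply/eqP; rewrite -subr_eq0 D c0.
  have pos k' : g' k' != 0.
    by apply: lt0r_neq0; have := D k'; have := g0 k'; lra.
  by case: one; apply: g'u.
have pos k' : g k' != 0.
  by apply: lt0r_neq0; have := D k'; have := g'0 k'; lra.
by case: one; apply: gu.
Qed.

End Heights.

Section HeightsOfStableCurves.

Variables (R : realType) (r n : nat).
Hypothesis hr : (1 < r)%N.
Implicit Types X : rn_curve R r n.

Lemma height_ge0 X (L : node r (clen X) -> R) m i k :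
  (forall e, 0 < L e) -> 0 <= height (G := dual X) L m i k.
Proof. by move=> L0; apply: sumr_ge0 => e _; apply: ltW. Qed.

Lemma height_neq0 X (L : node r (clen X) -> R) m i k :
  height (G := dual X) L m i k != 0 ->
  exists e, ((heavy X m).1 \in outer e) && ((light X i k).1 \in outer e).
Proof.
rewrite height_dual => h; apply/existsP; apply: contraNT h.
by rewrite negb_exists => /forallP E; rewrite big_pred0 // => e; apply/negbTE.
Qed.

(** Sets of light points cut off by a node are superlevel sets of the height. On the spoke of [m], a
    light point beyond [e] is cut off by every node that cuts off [e]; any other light point is cut
    off, together with [y^m], only by nodes strictly inside [e]. *)
Lemma height_outer X (L : node r (clen X) -> R) m i0 k0 i k e :
  stable X -> (forall e, 0 < L e) ->
  (heavy X m).1 \in outer e -> (light X i0 k0).1 = Some e ->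
  ((light X i k).1 \in outer e)
  = (height (G := dual X) L m i0 k0 <= height (G := dual X) L m i k).
Proof.
move=> st L0 me i0e; rewrite !height_dual i0e.
have [hs [hs_bij hsE]] := heavy_outer hr st.
have L0' e' : 0 <= L e' by apply: ltW.
case: (boolP (_ \in outer e)) => ike; apply/esym.
  rewrite big_mkcond [leRHS]big_mkcond /=; apply: ler_sum => e' _.
  case: (boolP (_ \in outer e')) => //= me'.
  case: (boolP (Some e \in outer e')) => [ee'|_]; first by rewrite (outer_trans ee' ike).
  by case: ifP.
apply/negbTE; rewrite -ltNge.
(* The node [e] counts only towards the height of [(i0, k0)], and its positive length makes the
   inequality strict. *)
rewrite [ltRHS](bigD1 e) /=; last by rewrite me outer_refl.
rewrite -[ltLHS]add0r; apply: ltr_leD => //.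
rewrite big_mkcond [leRHS]big_mkcond /=; apply: ler_sum => e' _.
case: (boolP (_ \in outer e')) => //= me'.
case: ifP => [ike'|_]; last by case: ifP.
suff -> : (Some e \in outer e') && (e' != e) by [].
have e'e : e' != e by apply: contraNneq ike => <-.
have ee' : e.1 = e'.1.
  by apply: (bij_inj hs_bij); move: me me'; rewrite !hsE => /eqP-> /eqP->.
rewrite e'e andbT; move: ike ike'; case: (light X i k).1 => [e2|]; last first.
  by rewrite !None_outer.
rewrite !Some_outer ee' eqxx => + /andP[e21 le2]; rewrite e21 -ltnNge /=.
by move=> /ltnW /leq_trans; apply.
Qed.

End HeightsOfStableCurves.

(** * Rigidity: the height vector determines the metric graph *)

Section Rigidity.

Variables (R : realType) (r n : nat).
Hypothesis hr : (1 < r)%N.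
Implicit Types X : rn_curve R r n.

Definition invariant_length X (L : node r (clen X) -> R) :=
  (forall e, 0 < L e) /\ (forall e, L (node_map (sigma X) e) = L e).

Lemma height_vec_inj X X' (L : node r (clen X) -> R)
    (L' : node r (clen X') -> R) :
  stable X -> stable X' -> invariant_length L -> invariant_length L' ->
  height_vec (G := dual X) L = height_vec (G := dual X') L' ->
  forall m i k, height (G := dual X) L m i k = height (G := dual X') L' m i k.
Proof.
move=> st st' [L0 Ls] [L'0 L's] LL' m i k.
have E0 : height (G := dual X) L 0 i =1 height (G := dual X') L' 0 i.
  apply: diag_proj_inj_ge0.
  - by move=> k'; apply: height_ge0.
  - by move=> k'; apply: height_ge0.
  - move=> k1 k2 /height_neq0 [e /andP[me ie]] /height_neq0 [e' /andP[me' ie']].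
    exact (light_spoke_inj hr st me ie me' ie').
  - move=> k1 k2 /height_neq0 [e /andP[me ie]] /height_neq0 [e' /andP[me' ie']].
    exact (light_spoke_inj hr st' me ie me' ie').
  - by move/ffunP: LL' => /(_ i); rewrite !ffunE.
(* Writing [m] as [0 + m] and [k] as [(k - m) + m] reduces to the heavy point [y^0] by
   equivariance. *)
rewrite -[m in LHS]add0r -[m in RHS]add0r -[m]natr_Zp -[k](subrK m%:R).
rewrite (height_shift (a := dual_aut X)) //.
by rewrite (height_shift (a := dual_aut X')).
Qed.

(** Take a light point on the component [e'] and the heavy point of its spoke. Their height is
    positive, so in [X] this light point lies on a component [e] of the spoke of the same heavy
    point, and both nodes cut off the same superlevel set. *)
Lemma same_labels_cut X X' (L : node r (clen X) -> R)
    (L' : node r (clen X') -> R) :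
  stable X -> stable X' -> (forall e, 0 < L e) -> (forall e, 0 < L' e) ->
  (forall m i k,
    height (G := dual X) L m i k = height (G := dual X') L' m i k) ->
  forall e', exists e, forall x,
    (dual_half_edge X' x \in outer e') = (dual_half_edge X x \in outer e).
Proof.
move=> st st' L0 L'0 LL' e'.
have [hs [hs_bij hsE]] := heavy_outer hr st.
have [hs' [hs'_bij hs'E]] := heavy_outer hr st'.
pose m := hs' e'.1.
have me' : (heavy X' m).1 \in outer e' by rewrite hs'E.
have [i0 [k0 i0e']] : exists i k, (light X' i k).1 = Some e'.
  by case: e' {m me'} => s j; apply: st'.2.
have : height (G := dual X) L m i0 k0 != 0.
  rewrite LL' height_dual (bigD1 e') /=; last by rewrite me' i0e' outer_refl.
  by apply: lt0r_neq0; apply: ltr_pwDl => //; apply: sumr_ge0 => e _; apply: ltW.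
case/height_neq0 => e1 /andP[me1].
case i0e: (light X i0 k0).1 => [e|]; last by rewrite None_outer.
rewrite Some_outer => /andP[/eqP ee1 _].
have me : (heavy X m).1 \in outer e by rewrite hsE ee1 -hsE.
exists e; case=> [||k|i k] /=; rewrite ?None_outer //.
  by rewrite hsE hs'E; move: me; rewrite hsE => /eqP->.
by rewrite (height_outer hr _ _ st' L'0 me' i0e')
  (height_outer hr _ _ st L0 me i0e) !LL'.
Qed.

(** Matching nodes by the labels they cut off, in both directions, gives inverse maps of nodes,
    hence an isomorphism. Lengths are then compared as differences of consecutive heights. *)
Lemma dual_rigid X X' (L : node r (clen X) -> R) (L' : node r (clen X') -> R) :
  stable X -> stable X' -> invariant_length L -> invariant_length L' ->
  height_vec (G := dual X) L = height_vec (G := dual X') L' ->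
  exists (fv : vert (dual X) -> vert (dual X'))
         (fe : edge (dual X) -> edge (dual X')),
    graph_iso fv fe /\ forall e, L' (fe e) = L e.
Proof.
move=> st st' LI LI' /(height_vec_inj st st' LI LI') LL'.
have [L0 _] := LI; have [L'0 _] := LI'.
have /boolp.choice [ge geE] := same_labels_cut st st' L0 L'0 LL'.
have /boolp.choice [fe feE] :=
  same_labels_cut st' st L'0 L0 (fun m i k => esym (LL' m i k)).
have label_ext Y (e e' : node r (clen Y)) : stable Y ->
    (forall x, (dual_half_edge Y x \in outer e)
      = (dual_half_edge Y x \in outer e')) -> e = e'.
  move=> sY E; apply: outer_ext => v.
  by have [x <-] := stable_labelled v sY.
have feK : cancel fe ge by move=> e; apply: label_ext => // x; rewrite -geE -feE.
have geK : cancel ge fe by move=> e; apply: label_ext => // x; rewrite -feE -geE.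
have [fv c] := contracts_of_labels st st' geE.
exists fv, fe; split; first exact: contracts_graph_iso c feK geK.
pose D e := L' e - L (ge e).
suff D0 e : D e = 0 by move=> e; have := D0 (fe e); rewrite /D feK => /subr0_eq.
(* Up to the identification of nodes, this sum is the difference of the two heights of a light point
   on [v], taken with the heavy point of its spoke. *)
have sumD v : \sum_(e' | v \in outer e') D e' = 0.
  case: v => [e1|]; last by rewrite big_pred0 // => e'; rewrite None_outer.
  have [hs' [hs'_bij hs'E]] := heavy_outer hr st'.
  have [i [k ike1]] : exists i k, (light X' i k).1 = Some e1.
    by case: (e1) => s j; apply: st'.2.
  rewrite (eq_bigl (fun e' => ((heavy X' (hs' e1.1)).1 \in outer e')
      && ((light X' i k).1 \in outer e'))); last first.
    move=> e'; rewrite ike1 hs'E Some_outer.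
    by case: (e1.1 =P e'.1) => [->|]; rewrite ?eqxx ?andbF.
  rewrite sumrB -height_dual -LL' height_dual.
  rewrite (reindex ge) /=; last by exists fe => ? _.
  apply/eqP; rewrite subr_eq0; apply/eqP; apply: eq_bigl => e'.
  have /= <- := geE e' (Lheavy (hs' e1.1)).
  by have /= <- := geE e' (Llight i k).
(* The nodes cutting off the component [e], other than [e] itself, are those cutting off [inward e],
   so the two sums differ by the single term at [e]. *)
have := sumD (Some e); rewrite (bigD1 e) ?outer_refl //=.
rewrite (eq_bigl (fun e' => inward e \in outer e')) ?sumD ?addr0 //.
by move=> e'; rewrite inward_outer eq_sym.
Qed.

End Rigidity.

(** * Coordinates of the height vector in a cone *)

Section ConeCoordinates.

Variables (R : realType) (r n : nat).
Implicit Types X : rn_curve R r n.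

Lemma diag_proj0 : diag_proj (0 : {ffun 'Z_r -> R^o}) = 0.
Proof. by apply: (addrI (diag_proj 0)); rewrite -diag_projD !addr0. Qed.

Lemma diag_proj_sum (T : Type) (s : seq T) (P : pred T) (c : T -> R)
    (x : T -> {ffun 'Z_r -> R^o}) :
  \sum_(j <- s | P j) c j *: diag_proj (x j)
  = diag_proj (\sum_(j <- s | P j) c j *: x j).
Proof.
rewrite (big_morph _ (@diag_projD R r) diag_proj0); apply: eq_bigr => j _.
exact: diag_scaleE.
Qed.

Definition decorated (I : chain r n) (i : 'I_n) (k : 'Z_r) : bool :=
  if insub i is Some u then decoration (c := I) u == k else false.

Lemma cone_gen_coord (I : chain r n) j i :
  cone_gen R I j i = diag_proj
    [ffun k => ((i \in chain_set I j) && decorated I i (- k))%:R : R^o].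
Proof.
rewrite /cone_gen sum_ffunE /decorated; case: insubP => [u _ uE|iN].
  case: (boolP (i \in chain_set I j)) => ij /=; last first.
    rewrite big1 => [|u' u'j].
      by rewrite -diag_proj0; congr diag_proj; apply/ffunP=> k; rewrite !ffunE.
    by rewrite ffunE; case: eqP => // iu'; rewrite iu' u'j in ij.
  rewrite (bigD1 u) /=; last by rewrite uE.
  rewrite big1 ?addr0 => [|u' /andP[_ u'u]]; last first.
    by rewrite ffunE -uE; case: eqP => // /val_inj uu'; rewrite uu' eqxx in u'u.
  rewrite ffunE -uE eqxx; congr diag_proj; apply/ffunP=> k; rewrite !ffunE.
  by rewrite -eqr_oppLR eq_sym.
rewrite big1 => [|u _].
  by rewrite -diag_proj0; congr diag_proj; apply/ffunP=> k; rewrite !ffunE andbF.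
by rewrite ffunE; case: eqP => // iu; case/negP: iN; rewrite iu; exact: valP u.
Qed.

(* What [has_type X I] says about the edges of the dual graph. *)
Definition cut_by X (I : chain r n) (s0 : 'I_r) : Prop :=
  forall e i k,
    ((heavy X 0).1 \in outer e) && ((light X i k).1 \in outer e)
    = [&& e.1 == s0, i \in chain_set I e.2.+1 & decorated I i k].

(** Group the edges of [H] by the level of the node of [X] they come from. By [cut_by] only the
    spoke [s0] contributes, and its node at level [j] meets each coordinate as the generator of
    I_(j+1) does. A contracted node gives an empty inner sum. *)
Lemma height_vec_contracts X (I : chain r n) (s0 : 'I_r) (H : graph r n)
    (L : edge H -> R) (fv : vert (dual X) -> vert H)
    (ge : edge H -> edge (dual X)) :
  cut_by X I s0 -> contracts fv ge ->
  height_vec L = \sum_(j < clen X)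
    (\sum_(e | ge e == (s0, j)) L e) *: cone_gen R I j.+1.
Proof.
move=> cut c; apply/ffunP=> i; rewrite sum_ffunE ffunE.
under [RHS]eq_bigr do rewrite ffunE cone_gen_coord.
rewrite diag_proj_sum; congr diag_proj; apply/ffunP=> k; rewrite sum_ffunE ffunE.
rewrite (height_contracts _ _ _ _ c).
under eq_bigl => e do rewrite !side_dual cut.
rewrite (partition_big (fun e => (ge e).2) predT) //=; apply: eq_bigr => j _.
rewrite !ffunE -[RHS]/(_ * _).
have E e : [&& (ge e).1 == s0, i \in chain_set I (ge e).2.+1
    & decorated I i (- k)] && ((ge e).2 == j)
  = (ge e == (s0, j)) && ((i \in chain_set I j.+1) && decorated I i (- k)).
  case: (ge e) => s j'; rewrite xpair_eqE /=.
  by case: (j' =P j) => [->|_]; rewrite ?andbT ?andbF.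
rewrite (eq_bigl _ _ E); case: (_ && decorated _ _ _).
  by rewrite mulr1; apply: eq_bigl => e; rewrite andbT.
by rewrite mulr0 big_pred0 // => e; rewrite andbF.
Qed.

End ConeCoordinates.

(** * Curves and chains *)

Section CurvesAndChains.

Variables (R : realType) (r n : nat).
Hypothesis hr : (1 < r)%N.
Implicit Types (X : rn_curve R r n) (I : chain r n).

Lemma chain_set_mono I j j' :
  (j <= j' <= chain_length I)%N -> chain_set I j \subset chain_set I j'.
Proof.
case/andP=> jj' j'l.
have sub_trans : transitive [rel A B : {set 'I_n} | A \subset B].
  by move=> B A C; apply: fintype.subset_trans.
have sub_refl : reflexive [rel A B : {set 'I_n} | A \subset B].
  by move=> A; apply: subxx.
have I_sub : sorted [rel A B : {set 'I_n} | A \subset B]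
    (finset.set0 :: chain_sets I).
  by apply: (sub_path _ (chain_setsP I)) => A B /=; apply: proper_sub.
apply: (sorted_leq_nth sub_trans sub_refl finset.set0 I_sub) => //.
by rewrite inE /= ltnS; apply: leq_trans j'l.
Qed.

Lemma chain_set_top I : chain_set I (chain_length I) = chain_top I.
Proof. by rewrite /chain_top (last_nth finset.set0). Qed.

Lemma decoratedP I i k : reflect
  (exists2 u : {i | i \in chain_top I}, val u = i & decoration (c := I) u = k)
  (decorated I i k).
Proof.
rewrite /decorated; apply: (iffP idP) => [|[u <- <-]]; last by rewrite valK.
by case: insubP => // u _ ui /eqP uk; exists u.
Qed.

Lemma type_cut_by X I : stable X -> has_type X I -> exists s0, cut_by X I s0.
Proof.
move=> st [lE onspoke _]; have [hs [[hs' hsK hsK'] hsE]] := heavy_outer hr st.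
exists (hs' 0) => e i k.
rewrite hsE -(can2_eq hsK hsK'); case: eqP => //= e0.
have /onspoke H : exists j, (heavy X 0).1 = Some (e.1, j).
  have : (heavy X 0).1 \in outer e by rewrite hsE e0.
  case: (heavy X 0).1 => [[s j]|]; last by rewrite None_outer.
  by rewrite Some_outer => /andP[/eqP /= -> _]; exists j.
have el : (e.2.+1 <= chain_length I)%N by rewrite -lE.
apply/idP/andP => [|[ie /decoratedP dec]].
  case lik: (light X i k).1 => [[s j]|]; last by rewrite None_outer.
  rewrite Some_outer /= => /andP[/eqP se je]; move: lik; rewrite se.
  case/H; rewrite inE => /andP[_ ij] dec; split; last by apply/decoratedP.
  by apply: fintype.subsetP ij; apply: chain_set_mono; rewrite ltnS je.
(* The first I_j containing [i] has positive index since I_0 is empty; one less is the level of the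
   component carrying the light point. *)
have [[|j] ij j_min] := ex_minnP (ex_intro (fun j => i \in chain_set I j) _ ie).
  by rewrite inE in ij.
have je : (j < e.2.+1)%N by apply: j_min.
have jl : (j < clen X)%N by rewrite lE; apply: leq_trans el.
have /= -> : (light X i k).1 = Some (e.1, Ordinal jl).
  apply/H; split=> //; rewrite inE ij andbT.
  by apply/negP => /j_min; rewrite ltnn.
by rewrite Some_outer eqxx.
Qed.

(** The chain is read off from the spoke [s0] of [y^0]: [B m] collects the orbits meeting its [m]
    outermost components, and the decoration is the unique superscript found on the spoke. *)
Lemma stable_chain X : stable X ->
  exists I s0, clen X = chain_length I /\ cut_by X I s0.
Proof.
move=> st; have [hs [[hs' hsK hsK'] hsE]] := heavy_outer hr st.
pose s0 := hs' 0.
have heavy_s0 j : (heavy X 0).1 \in outer (s0, j) by rewrite hsE /= hsK'.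
pose on_spoke i k (j : 'I_(clen X)) := (light X i k).1 == Some (s0, j).
have on_spoke_inj i k k' j j' : on_spoke i k j -> on_spoke i k' j' -> k = k'.
  move=> /eqP ij /eqP ij'.
  apply: (light_spoke_inj (i := i) hr st (heavy_s0 j) _ (heavy_s0 j') _).
    by rewrite ij outer_refl.
  by rewrite ij' outer_refl.
pose B m := [set i | [exists k, exists j : 'I_(clen X), (j < m)%N && on_spoke i k j]].
have BP m i : reflect
    (exists k (j : 'I_(clen X)), (j < m)%N /\ on_spoke i k j) (i \in B m).
  rewrite inE; apply: (iffP existsP) => -[k].
    by case/existsP=> j /andP[? ?]; exists k, j.
  by case=> j [? ?]; exists k; apply/existsP; exists j; apply/andP.
pose sets := mkseq (fun j => B j.+1) (clen X).
have setsE m : (m <= clen X)%N -> nth finset.set0 (finset.set0 :: sets) m = B m.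
  case: m => [_|m ml] /=; last by rewrite nth_mkseq.
  by apply/setP=> i; rewrite [LHS]inE; apply/esym/BP => -[k [j []]].
have setsP : path [rel A B : {set 'I_n} | A \proper B] finset.set0 sets.
  apply/(pathP finset.set0) => m; rewrite size_mkseq => ml /=.
  rewrite setsE 1?ltnW // nth_mkseq //; apply/properP; split.
    apply/fintype.subsetP=> i /BP [k [j [jm ij]]]; apply/BP; exists k, j.
    by split=> //; apply: ltnW.
  (* Strictness: the component at level [m] carries a light point, whose orbit meets the spoke only
     once and so not further out. *)
  have [i [k ik]] := st.2 s0 (Ordinal ml).
  have ikm : on_spoke i k (Ordinal ml) by apply/eqP.
  exists i; first by apply/BP; exists k, (Ordinal ml).
  apply/BP => -[k' [j [jm ij]]]; move: (on_spoke_inj _ _ _ _ _ ikm ij) => kk'.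
  by move: ij jm; rewrite /on_spoke -kk' ik => /eqP [<-] /=; rewrite ltnn.
(* The default 0 is taken only when no point of the orbit lies on the spoke. *)
pose a i := odflt 0 [pick k | [exists j, on_spoke i k j]].
have aE i k j : on_spoke i k j -> a i = k.
  move=> ij; rewrite /a; case: pickP => [k' /existsP[j' ij']|/(_ k)] /=.
    exact: on_spoke_inj ij' ij.
  by move=> /negbT /negP[]; apply/existsP; exists j.
pose I := Chain setsP (fun u => a (val u)); exists I, s0.
have lE : clen X = chain_length I by rewrite /chain_length size_mkseq.
split=> // e i k; rewrite hsE (can2_eq hsK hsK') -/s0; case: eqP => //= es0.
have -> : chain_set I e.2.+1 = B e.2.+1 by apply: setsE.
have decE : decorated I i k = (i \in B (clen X)) && (a i == k).
  have <- : chain_top I = B (clen X) by rewrite -chain_set_top -lE; apply: setsE.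
  by rewrite /decorated; case: insubP => [u -> <-|/negbTE->].
rewrite decE; apply/idP/and3P => [|[/BP[k' [j [je ij]]] _ /eqP <-]]; last first.
  by rewrite (aE _ _ _ ij) (eqP ij) Some_outer es0 eqxx.
case lik: (light X i k).1 => [[s j]|]; last by rewrite None_outer.
rewrite Some_outer /= => /andP[/eqP se je].
have ij : on_spoke i k j by rewrite /on_spoke lik se es0.
split; last by rewrite (aE _ _ _ ij).
  by apply/BP; exists k, j.
by apply/BP; exists k, j; split.
Qed.

End CurvesAndChains.

(** * A stable curve of given type *)

Section ModelCurve.

Variables (R : realType) (r' n : nat) (zeta : R[i]).
Local Notation r := r'.+2.
Hypothesis hz : r.-primitive_root zeta.
Variables (l : nat) (d : 'I_n -> option 'I_l) (a : 'I_n -> 'Z_r).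

Lemma zeta_neq0 : zeta != 0.
Proof. by rewrite (prim_root_eq0 hz). Qed.

Lemma zeta_exp_neq0 m : zeta ^+ m != 0.
Proof. by rewrite expf_neq0 ?zeta_neq0. Qed.

Lemma zeta_exp_inj (k k' : 'Z_r) : zeta ^+ k = zeta ^+ k' -> k = k'.
Proof.
move/eqP; rewrite (eq_prim_root_expr hz) !modn_small ?ltn_ord //.
by move/eqP/val_inj.
Qed.

Lemma zeta_expS (k : 'Z_r) : zeta ^+ (k + 1)%R = zeta * zeta ^+ k.
Proof.
have -> : (k + 1)%R = ((k + 1) %% r)%N :> nat by rewrite /= modnDmr.
by rewrite (prim_expr_mod hz) addn1 exprS.
Qed.

(** With [r] of the form [r'.+2] the types ['I_r] and ['Z_r] are convertible, so spokes are rotated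
    by addition. *)
Definition next_node (e : node r l) : node r l := (((e.1 : 'Z_r) + 1)%R, e.2).

Lemma next_node_inj : injective next_node.
Proof.
move=> [s j] [s' j'] E; congr (_, _); last exact (congr1 snd E).
exact (addIr (1 : 'Z_r) (congr1 fst E)).
Qed.

Lemma next_component_inj : injective (omap next_node : component r l -> component r l).
Proof. exact: inj_omap next_node_inj. Qed.

(** On a non-central component the inner node is at infinity and the outer one, if any, at 0; the
    spoke [s] meets the center at [zeta ^+ s]. *)
Definition model_att (e : node r l) (b : bool) : P1 R :=
  if b then if e.2.+1 == l then Some (zeta ^+ e.1) else Some 0 else None.

Lemma inward_None (e : node r l) : e.2.+1 = l -> inward e = None.
Proof. by move=> el; rewrite /inward insubF //; apply/negbTE; rewrite -leqNgt el. Qed.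

Lemma inward_Some (e : node r l) : e.2.+1 <> l ->
  exists2 j : 'I_l, inward e = Some (e.1, j) & j = e.2.+1 :> nat.
Proof.
move=> el; rewrite /inward; case: insubP => [j _ je|]; first by exists j.
by rewrite -leqNgt => le; case: el; apply/eqP; rewrite eqn_leq le ltn_ord.
Qed.

Lemma model_att_inj :
  injective (fun eb : node r l * bool => branch model_att eb.1 eb.2).
Proof.
have E e : branch model_att e true =
    if e.2.+1 == l then (None, Some (zeta ^+ e.1)) else (inward e, Some 0).
  by rewrite /branch /model_att; case: eqP => // /inward_None->.
case=> [e b] [e' b'] /=; case: b; case: b'; rewrite ?E.
- case: eqP => [el|/inward_Some [j ej jE]]; case: eqP => [e'l|/inward_Some [j' ej' jE']].
  + case=> /zeta_exp_inj ee'; congr (_, true); apply/eqP.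
    by rewrite node_eqE ee' eqxx /= -eqSS el e'l.
  + by rewrite ej'.
  + by rewrite ej.
  + rewrite ej ej' => -[ee' jj']; congr (_, true); apply/eqP.
    by rewrite node_eqE ee' eqxx /= -eqSS -jE -jE' jj'.
- by case: eqP.
- by case: eqP.
- by case=> ->.
Qed.

Definition model_pinwheel : pinwheel R r := Pinwheel model_att_inj.

Definition model_line (v : component r l) (p : P1 R) : P1 R :=
  if v is Some _ then p else omap ( *%R zeta) p.

Lemma model_line_aut v : P1_automorphism (model_line v).
Proof.
case: v => [e|].
  exists 1, 0, 0, 1; split; first by rewrite mulr1 mul0r subr0 oner_neq0.
  case=> [u|] /=; last by rewrite eqxx.
  by rewrite mul0r add0r (negbTE (oner_neq0 _)) mul1r addr0 divr1.
exists zeta, 0, 0, 1; split; first by rewrite mulr1 mul0r subr0 zeta_neq0.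
case=> [u|] /=; last by rewrite eqxx.
by rewrite mul0r add0r (negbTE (oner_neq0 _)) addr0 divr1.
Qed.

Lemma model_node_mapP (e : node r l) :
  range (aut_act (perm next_component_inj) model_line \o branch model_att e)
  = range (branch model_att (perm next_node_inj e)).
Proof.
apply: (congr1 (fun f => range f)); apply/funext => b; rewrite /aut_act /= !permE /branch.
case: b => //=; rewrite /model_att /=; case: eqP => el.
  by rewrite !inward_None //= zeta_expS.
have [j -> jE] := inward_Some el.
have [//|j' -> j'E] := @inward_Some (next_node e).
by rewrite /= /next_node /=; congr (Some (_, _), _); apply: val_inj; rewrite /= jE j'E.
Qed.

Definition model_aut : pinwheel_aut model_pinwheel :=
  PinwheelAut (C := model_pinwheel) model_line_aut model_node_mapP.

(** The coordinate 0 is free of nodes on an outermost component. For [l = 0] the heavy orbit is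
    placed where spokes would be attached. *)
Definition model_heavy (k : 'Z_r) : cpoint model_pinwheel :=
  if insub 0%N is Some j then (Some (k : 'I_r, j), Some 0)
  else (None, Some (zeta ^+ k)).

(** The shift by [a i] puts z_i^k on the spoke 0 of [y^0] exactly when [k = a i]. Central light
    points are placed at x^-, a coincidence that is allowed. *)
Definition model_light (i : 'I_n) (k : 'Z_r) : cpoint model_pinwheel :=
  if d i is Some j then (Some ((k - a i)%R : 'I_r, j), Some 1)
  else (None, Some 0).

Lemma act_model (v : component r l) p :
  Defs.act model_aut (v, p) = (omap next_node v, model_line v p).
Proof. by rewrite /Defs.act /aut_act /= permE. Qed.

Lemma iter_act_model m (v : component r l) p : iter m (Defs.act model_aut) (v, p)
  = (omap (fun e : node r l => (((e.1 : 'Z_r) + m%:R)%R : 'I_r, e.2)) v,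
     if v is Some _ then p else omap ( *%R (zeta ^+ m)) p).
Proof.
elim: m => [|m IH] /=.
  by case: v p => [[s j]|] [u|] //=; rewrite ?addr0 // expr0 mul1r.
rewrite IH act_model; case: v p {IH} => [[s j]|] [u|] //=.
- by rewrite /next_node /= -natr1 addrA.
- by rewrite /next_node /= -natr1 addrA.
- by rewrite exprS mulrA.
Qed.

Lemma model_sigma_order m :
  (forall p, iter m (Defs.act model_aut) p = p) <-> (r %| m)%N.
Proof.
split=> [H|rm [v p]].
  (* The central point 1 moves through the powers of [zeta], so it detects the order. *)
  have := H (None, Some 1); rewrite iter_act_model /= mulr1 => -[] /eqP.
  by rewrite -(prim_order_dvd hz).
have m0 : m%:R = 0 :> 'Z_r by apply: val_inj; rewrite /= val_Zp_nat //; apply/eqP.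
have zm : zeta ^+ m = 1 by apply/eqP; rewrite -(prim_order_dvd hz).
rewrite iter_act_model m0 zm.
by case: v p => [[s j]|] [u|] //=; rewrite ?addr0 // mul1r.
Qed.

Lemma model_heavy_outer k e : ((model_heavy k).1 \in outer e) = (k == e.1 :> 'Z_r).
Proof.
rewrite /model_heavy; case: insubP => [j _ j0|].
  by rewrite Some_outer /= j0 leq0n andbT.
by rewrite -leqNgt => l0; have := leq_trans (ltn_ord e.2) l0.
Qed.

Lemma model_smooth (p : cpoint model_pinwheel) :
  (forall e, p <> (Some e, None)) ->
  (forall e : node r l, e.2 != 0%N :> nat -> p <> (Some e, Some 0)) ->
  (forall k, (0 < l)%N -> p <> (None, Some (zeta ^+ k))) -> smooth p.
Proof.
move=> p_out p_in p_center e [|]; last exact/nesym/p_out.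
rewrite /branch /= /model_att; case: eqP => [el|/inward_Some [j -> jE]].
  by rewrite inward_None //; apply/nesym/p_center; apply: leq_trans (ltn_ord e.2).
by apply/nesym/p_in; rewrite jE.
Qed.

Lemma model_xplus_smooth : smooth (C := model_pinwheel) (None, None).
Proof. by apply: model_smooth. Qed.

Lemma model_xminus_smooth : smooth (C := model_pinwheel) (None, Some 0).
Proof.
apply: model_smooth => // k _ [] /eqP.
by rewrite eq_sym (negbTE (zeta_exp_neq0 _)).
Qed.

Lemma model_heavy_smooth k : smooth (model_heavy k).
Proof.
rewrite /model_heavy; case: insubP => [j _ j0|l0]; apply: model_smooth => //.
  by move=> e e0 [] ej; rewrite -ej /= j0 in e0.
by move=> k'; rewrite (negbTE l0).
Qed.

Lemma model_light_smooth i k : smooth (model_light i k).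
Proof.
rewrite /model_light; case: (d i) => [j|]; last exact: model_xminus_smooth.
by apply: model_smooth => // e _ [] _ /eqP; rewrite oner_eq0.
Qed.

Lemma model_light_orbit i k :
  Defs.act model_aut (model_light i k) = model_light i (k + 1).
Proof.
rewrite /model_light; case: (d i) => [j|]; rewrite act_model /= ?mulr0 //.
by rewrite /next_node /= addrAC.
Qed.

Lemma model_heavy_orbit k :
  Defs.act model_aut (model_heavy k) = model_heavy (k + 1).
Proof.
rewrite /model_heavy; case: insubP => [j _ _|_]; rewrite act_model //=.
by rewrite zeta_expS.
Qed.

Lemma model_heavy_inj : injective model_heavy.
Proof.
move=> k k'; rewrite /model_heavy; case: insubP => [j _ _|_]; first by case.
by case=> /zeta_exp_inj.
Qed.

Lemma model_heavy_xplus k : model_heavy k <> (None, None).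
Proof. by rewrite /model_heavy; case: insubP. Qed.

Lemma model_heavy_xminus k : model_heavy k <> (None, Some 0).
Proof.
rewrite /model_heavy; case: insubP => [//|_] [] /eqP.
by rewrite (negbTE (zeta_exp_neq0 _)).
Qed.

Lemma model_heavy_light k i k' : model_heavy k <> model_light i k'.
Proof.
rewrite /model_light; case: (d i) => [j|]; last exact: model_heavy_xminus.
rewrite /model_heavy; case: insubP => [j' _ _|//] [] _ _ /eqP.
by rewrite eq_sym oner_eq0.
Qed.

Lemma model_xplus_neq : None <> Some 0 :> P1 R.
Proof. by []. Qed.

Lemma model_xplus_fixed : Defs.act model_aut (None, None) = (None, None).
Proof. by rewrite act_model. Qed.

Lemma model_xminus_fixed : Defs.act model_aut (None, Some 0) = (None, Some 0).
Proof. by rewrite act_model /= mulr0. Qed.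

Definition model : rn_curve R r n :=
  RnCurve model_sigma_order model_xplus_smooth model_xminus_smooth
    model_heavy_smooth model_light_smooth model_xplus_neq model_xplus_fixed
    model_xminus_fixed model_light_orbit model_heavy_orbit model_heavy_inj
    model_heavy_xplus model_heavy_xminus model_heavy_light.

Lemma model_light_outer i k e : ((light model i k).1 \in outer e)
  = (if d i is Some j then (j <= e.2)%N else false) && (k - a i == e.1 :> 'Z_r).
Proof.
rewrite /= /model_light; case: (d i) => [j|]; last by rewrite None_outer.
by rewrite Some_outer /= andbC.
Qed.

Lemma model_in_Lbar : (forall j, exists i, d i = Some j) -> in_Lbar zeta model.
Proof.
move=> d_surj; split; last first.
  exists id; split=> //; exists 1, 0, 0, 1; split.
    by rewrite mulr1 mul0r subr0 oner_neq0.
  case=> [u|] /=; last by rewrite eqxx.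
  by rewrite mul0r add0r (negbTE (oner_neq0 _)) mul1r addr0 divr1.
split=> s j => [j0|].
  exists s; split=> [|k] /=; rewrite /model_heavy; case: insubP => [j' _ j'0|].
  - by congr (Some (_, _)); apply: val_inj; rewrite /= j'0 j0.
  - by rewrite -leqNgt => l0; have := leq_trans (ltn_ord j) l0.
  - by case.
  - by [].
have [i ij] := d_surj j; exists i, ((s : 'Z_r) + a i).
by rewrite /= /model_light ij addrK.
Qed.

End ModelCurve.

(** * The model curve of a chain *)

Section ModelOfChain.

Variables (R : realType) (r' n : nat) (zeta : R[i]).
Local Notation r := r'.+2.
Hypothesis hz : r.-primitive_root zeta.
Variable I : chain r n.

(** The first set containing [i] gives the level of its orbit; when there is none, [insub] fails and
    the orbit is central. *)
Definition chain_depth (i : 'I_n) : option 'I_(chain_length I) :=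
  insub (find (fun A : {set 'I_n} => i \in A) (chain_sets I)).

Definition chain_deco (i : 'I_n) : 'Z_r :=
  if insub i is Some u then decoration (c := I) u else 0.

Lemma chain_depth_le i (j : 'I_(chain_length I)) :
  (if chain_depth i is Some j' then (j' <= j)%N else false)
  = (i \in chain_set I j.+1).
Proof.
rewrite /chain_depth; set p := fun A : {set 'I_n} => i \in A.
have ijE : i \in chain_set I j.+1 = p (nth finset.set0 (chain_sets I) j) by [].
have jl : (j < size (chain_sets I))%N := ltn_ord j.
case: insubP => [j' fl jE|nfl]; last first.
  apply/esym; apply/negbTE; apply: contraNN nfl => ij.
  by rewrite -has_find; apply/(has_nthP finset.set0); exists (j : nat).
rewrite jE; apply/idP/idP => [fj|ij]; last first.
  by rewrite leqNgt; apply/negP => /(before_find finset.set0); rewrite -ijE ij.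
have pf : i \in chain_set I (find p (chain_sets I)).+1.
  by apply: (nth_find finset.set0 (a := p)); rewrite has_find.
by apply: fintype.subsetP pf; apply: chain_set_mono; rewrite ltnS fj.
Qed.

Lemma chain_depth_eq i j : (chain_depth i = Some j)
  <-> i \in chain_set I j.+1 :\: chain_set I j.
Proof.
rewrite inE -chain_depth_le; case dE: (chain_depth i) => [j'|]; last by rewrite andbF.
have lt_j : (i \in chain_set I j) = (j' < j)%N.
  case: j => [[|j] jl] /=; first by rewrite ltn0 inE.
  by rewrite -[j in LHS]/(val (Ordinal (ltnW jl))) -chain_depth_le dE.
rewrite lt_j -leqNgt -eqn_leq eq_sym; split=> [[->] //|/eqP E].
by congr Some; apply: val_inj.
Qed.

Lemma chain_depth_top i : isSome (chain_depth i) = (i \in chain_top I).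
Proof.
rewrite -chain_set_top; apply/idP/idP => [|ij].
  case dE: (chain_depth i) => [j|//] _.
  have : i \in chain_set I j.+1 by rewrite -chain_depth_le dE.
  by apply: fintype.subsetP; apply: chain_set_mono; rewrite ltn_ord leqnn.
case: (posnP (chain_length I)) => [l0|l_gt0]; first by rewrite l0 inE in ij.
have lt_l : ((chain_length I).-1 < chain_length I)%N by rewrite prednK.
have := chain_depth_le i (Ordinal lt_l); rewrite /= prednK // ij.
by case: chain_depth.
Qed.

Lemma chain_depth_decorated i k :
  isSome (chain_depth i) -> decorated I i k = (chain_deco i == k).
Proof.
by rewrite chain_depth_top /decorated /chain_deco => itop; rewrite insubT.
Qed.

Lemma chain_depth_surj j : exists i, chain_depth i = Some j.
Proof.
have jl : (j < size (chain_sets I))%N := ltn_ord j.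
have /pathP := chain_setsP I => /(_ finset.set0 j jl) /= /properP [_ [i ij iNj]].
by exists i; apply/chain_depth_eq; rewrite inE ij iNj.
Qed.

Definition chain_model : rn_curve R r n := model hz chain_depth chain_deco.

Lemma chain_model_in_Lbar : in_Lbar zeta chain_model.
Proof.
exact: model_in_Lbar chain_depth_surj.
Qed.

(** The spoke of [y^0] is the spoke 0, and z_i^k lies on the spoke [k - a(i)], which is 0 exactly
    when [k] is the decoration of [i]. *)
Lemma chain_model_type : has_type chain_model I.
Proof.
split=> // [s|i k]; last first.
  rewrite -chain_depth_top /= /model_light.
  by case: (chain_depth i) => [j|] //=; split.
case=> j0; rewrite /= /model_heavy; case: insubP => [_ _ _ /= [s0 _]|_ [//]].
move=> j i k; rewrite -chain_depth_eq.
have decE := @chain_depth_decorated i k; rewrite /= /model_light.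
case dE: (chain_depth i) decE => [j'|] decE; last by split=> [//|[]].
have dec := rwP (decoratedP I i k); rewrite decE // in dec.
split=> [[ks <-]|[[<-] /dec/eqP kE]].
  split=> //; apply/dec; rewrite eq_sym -subr_eq0; apply/eqP.
  exact (etrans ks (esym s0)).
by congr (Some (_, _)); rewrite kE subrr -s0.
Qed.

End ModelOfChain.

(** * Tropical curves and the fan *)

Section TropicalVectors.

Variables (R : realType) (r n : nat) (zeta : R[i]).
Hypothesis hr : (1 < r)%N.
Implicit Types (t : tropical_curve r n zeta) (X : rn_curve R r n).
Implicit Types (I : chain r n).

Definition tropical_vec t : fan_space R r n := height_vec (@tlength _ _ _ _ t).

Lemma tropical_vec_iso t t' : tropical_iso t t' -> tropical_vec t = tropical_vec t'.
Proof.
case=> fv [fe [[iso _ _] lenE]]; rewrite /tropical_vec (height_vec_iso _ iso).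
exact/eq_height_vec/fsym.
Qed.

Lemma tropical_iso_refl t : tropical_iso t t.
Proof.
exists id, id; split=> //; split=> //; split=> //; try by exists id.
by move=> e; rewrite imset_id.
Qed.

(** The automorphism of [t] comes from some stable curve, and isomorphisms between dual graphs of
    stable curves are equivariant. *)
Lemma tropical_iso_equivariant t X (fv : vert (dual X) -> vert (tgraph t))
    (fe : edge (dual X) -> edge (tgraph t)) :
  stable X -> graph_iso fv fe ->
  graph_aut_iso (dual_aut X) (tsigma t) fv fe.
Proof.
move=> st iso; have [X0 [[st0 _] [fv0 [fe0 aiso0]]]] := tdual t.
have [[[gv0 fvK gvK] [ge0 feK geK] _ _] _ _] := aiso0.
have [iso0 ev0 ee0] := aiso0.
have iso' := graph_iso_comp iso (graph_iso_sym fvK gvK feK geK iso0).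
have [_ ev ee] := dual_iso_equivariant st iso'; split=> // [v|e].
  by rewrite -[LHS]gvK [gv0 _]ev ev0 /= gvK.
by rewrite -[LHS]geK [ge0 _]ee ee0 /= geK.
Qed.

Lemma tropical_invariant_length t X (fv : vert (dual X) -> vert (tgraph t))
    (fe : edge (dual X) -> edge (tgraph t)) :
  stable X -> graph_iso fv fe -> invariant_length (X := X) (@tlength _ _ _ _ t \o fe).
Proof.
move=> st iso; split=> e /=; first exact: tlength_gt0.
have [_ _ ee] := tropical_iso_equivariant st iso.
by rewrite [RHS]tlength_sigma -ee.
Qed.

Lemma tropical_vec_inj t t' : tropical_vec t = tropical_vec t' -> tropical_iso t t'.
Proof.
have [X [[st _] [fv [fe aiso]]]] := tdual t.
have [X' [[st' _] [fv' [fe' aiso']]]] := tdual t'.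
have [iso _ _] := aiso; have [iso' _ _] := aiso'.
rewrite /tropical_vec (height_vec_iso _ iso) (height_vec_iso _ iso').
have LI := tropical_invariant_length st iso.
have LI' := tropical_invariant_length st' iso'.
case/(dual_rigid hr st st' LI LI') => gv [ge [giso lenE]].
have [[fw fvK fwK] [fd feK fdK] _ _] := iso.
exists (fv' \o (gv \o fw)), (fe' \o (ge \o fd)); split.
  apply: graph_aut_iso_comp aiso'.
  apply: graph_aut_iso_comp (graph_aut_iso_sym fvK fwK feK fdK aiso) _.
  exact: dual_iso_equivariant.
by move=> e /=; have /= -> := lenE (fd e); rewrite fdK.
Qed.

(** The height vector uses the spoke [s0] of [y^0], but invariant lengths agree on all spokes, so
    any [s] may be used. *)
Lemma tropical_vec_type t I X (fv : vert (dual X) -> vert (tgraph t))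
    (fe : edge (dual X) -> edge (tgraph t)) s0 (s : 'I_r) :
  stable X -> cut_by X I s0 -> graph_iso fv fe ->
  tropical_vec t
  = \sum_(j < clen X) tlength (fe (s, j)) *: cone_gen R I j.+1.
Proof.
move=> st cut iso; have [ge [feK geK c]] := graph_iso_contracts iso.
rewrite /tropical_vec (height_vec_contracts _ cut c).
apply: eq_bigr => j _; congr (_ *: _).
rewrite (big_pred1 (fe (s0, j))) => [|e]; last by rewrite /= (can2_eq geK feK).
have [_ L] := tropical_invariant_length st iso.
exact (node_map_inv hr s0 s j st L).
Qed.

Lemma sum_cone I l (c : 'I_l -> R) : l = chain_length I -> (forall j, 0 <= c j) ->
  cone R I (\sum_(j < l) c j *: cone_gen R I j.+1).
Proof. by move=> lE; rewrite lE in c * => c0; exists c. Qed.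

Lemma contraction_cone t I X :
  in_Lbar zeta X -> has_type X I -> contraction (dual X) (tgraph t) ->
  cone R I (tropical_vec t).
Proof.
move=> [st _] type [fv [ge c]]; have [s0 cut] := type_cut_by hr st type.
rewrite /tropical_vec (height_vec_contracts (fv := fv) _ cut c).
apply: sum_cone; first by case: type.
by move=> j; apply: sumr_ge0 => e _; apply/ltW/tlength_gt0.
Qed.

Lemma tropical_vec_support t : fan_support R r n (tropical_vec t).
Proof.
have [X [[st _] [fv [fe [iso _ _]]]]] := tdual t.
have [I [s0 [lE cut]]] := stable_chain hr st; exists I => //.
rewrite (tropical_vec_type s0 st cut iso); apply: sum_cone => // j.
exact/ltW/tlength_gt0.
Qed.

End TropicalVectors.

(** * Realizing each point of a cone by a tropical curve *)

Section Realization.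

Variables (R : realType) (r' n : nat) (zeta : R[i]).
Local Notation r := r'.+2.
Hypothesis hz : r.-primitive_root zeta.
Variables (I : chain r n) (c : 'I_(chain_length I) -> R).
Hypothesis c_ge0 : forall j, 0 <= c j.

Local Notation l := (chain_length I).

(** The levels that survive: a zero coefficient means that the corresponding orbit of nodes is
    contracted. *)
Definition kept : seq 'I_l := [seq j <- enum 'I_l | 0 < c j].

Definition kept_nth (j : 'I_(size kept)) : 'I_l := tnth (in_tuple kept) j.

Lemma kept_nth_gt0 j : 0 < c (kept_nth j).
Proof. by have := mem_tnth j (in_tuple kept); rewrite mem_filter => /andP[]. Qed.

Lemma kept_nth_inj : injective kept_nth.
Proof.
move=> j j' E; apply: val_inj; apply/eqP.
have x0 := kept_nth j.
have kept_uniq : uniq kept by apply: filter_uniq; apply: enum_uniq.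
rewrite -(nth_uniq x0 (ltn_ord j) (ltn_ord j')) //.
by rewrite -!(tnth_nth _ (in_tuple kept)) -/(kept_nth j) E.
Qed.

Lemma kept_nth_surj j : 0 < c j -> exists j', kept_nth j' = j.
Proof.
move=> cj; have : j \in in_tuple kept by rewrite mem_filter cj mem_enum.
by case/tnthP=> j' ->; exists j'.
Qed.

Lemma kept_nth_ltn (j j' : 'I_(size kept)) : (kept_nth j < kept_nth j')%N = (j < j')%N.
Proof.
have lt_mono (k k' : 'I_(size kept)) : (k < k')%N -> (kept_nth k < kept_nth k')%N.
  have x0 := kept_nth k; rewrite /kept_nth !(tnth_nth x0) => kk'.
  pose ltl := [rel x y : 'I_l | (x < y)%N].
  have ltl_trans : transitive ltl by move=> y x z; apply: ltn_trans.
  apply: (sorted_ltn_nth ltl_trans x0) => //; last 2 first.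
  - by rewrite inE.
  - by rewrite inE.
  apply: sorted_filter => //.
  have := iota_ltn_sorted 0 l; rewrite -val_enum_ord sorted_map.
  by apply: sub_sorted.
case: (ltngtP j j') => [/lt_mono//|/lt_mono|/val_inj->]; last by rewrite ltnn.
by move=> /ltnW; rewrite leqNgt => /negbTE.
Qed.

(** Contracting nodes moves an orbit inwards to the first surviving level, or to the center if none
    remains. *)
Definition kept_depth (i : 'I_n) : option 'I_(size kept) :=
  if chain_depth I i is Some j then
    insub (find (fun k : 'I_l => (j <= k)%N) kept)
  else None.

Lemma kept_depth_le i (j : 'I_(size kept)) :
  (if kept_depth i is Some j' then (j' <= j)%N else false)
  = (if chain_depth I i is Some j' then (j' <= kept_nth j)%N else false).
Proof.
rewrite /kept_depth; case: chain_depth => [d|//]; have x0 := kept_nth j.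
set p := fun k : 'I_l => (d <= k)%N.
have pE k : p (kept_nth k) = p (nth x0 kept k) by rewrite /kept_nth (tnth_nth x0).
rewrite -[RHS]/(p (kept_nth j)).
case: insubP => [j' fl jE|nfl]; last first.
  apply/esym; apply/negbTE; apply: contraNN nfl => pj.
  by rewrite -has_find; apply/hasP; exists (kept_nth j) => //; apply: mem_tnth.
apply/idP/idP => [j'j|]; last first.
  by rewrite leqNgt pE; apply: contraL => jj'; rewrite (before_find x0) // -jE.
have : p (kept_nth j') by rewrite pE jE nth_find // has_find.
move/leq_trans; apply; rewrite leqNgt kept_nth_ltn -leqNgt //.
Qed.

Lemma kept_depth_surj j : exists i, kept_depth i = Some j.
Proof.
have [i ij] := chain_depth_surj (kept_nth j); exists i.
have := kept_depth_le i j; rewrite ij leqnn.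
case dE: (kept_depth i) => [j'|//] j'j.
have := kept_depth_le i j'; rewrite dE ij leqnn leqNgt kept_nth_ltn -leqNgt.
by move=> /esym jj'; congr Some; apply/val_inj/eqP; rewrite eqn_leq j'j.
Qed.

Definition kept_model : rn_curve R r n := model hz kept_depth (chain_deco I).

Definition kept_length (e : edge (dual kept_model)) : R := c (kept_nth e.2).

Lemma kept_length_sigma e :
  kept_length e = kept_length (edge_map (dual_aut kept_model) e).
Proof. by rewrite /kept_length /= permE. Qed.

Lemma kept_dual : exists X : rn_curve R r n, in_Lbar zeta X /\
  exists fv fe, graph_aut_iso (dual_aut X) (dual_aut kept_model) fv fe.
Proof.
exists kept_model; split; first exact: model_in_Lbar kept_depth_surj.
exists id, id; split=> //; split=> //; try by exists id.
by move=> e; rewrite imset_id.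
Qed.

Definition kept_tropical : tropical_curve r n zeta :=
  TropicalCurve (fun e => kept_nth_gt0 e.2 : 0 < kept_length e)
    kept_length_sigma kept_dual.

(** A surviving node cuts off the same labels as the node of the full model at its original level,
    by [kept_depth_le]. *)
Lemma kept_contracts : exists fv,
  contracts (G := dual (chain_model hz I)) (H := dual kept_model) fv
    (fun e => (e.1, kept_nth e.2)).
Proof.
apply: contracts_of_labels.
- by have [] := chain_model_in_Lbar hz I.
- by have [] := model_in_Lbar hz (chain_deco I) kept_depth_surj.
move=> e [||k|i k]; rewrite /= ?None_outer //.
  by rewrite !model_heavy_outer.
by rewrite !model_light_outer kept_depth_le.
Qed.

Lemma kept_T_chain : T_chain I (tropical_class kept_tropical).
Proof.
exists kept_tropical, (chain_model hz I); split=> //.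
- exact: chain_model_in_Lbar.
- exact: chain_model_type.
by have [fv fvP] := kept_contracts; exists fv, (fun e => (e.1, kept_nth e.2)).
Qed.

Lemma kept_tropical_vec :
  tropical_vec kept_tropical = \sum_j c j *: cone_gen R I j.+1.
Proof.
have [st _] := chain_model_in_Lbar hz I.
have [s0 cut] := type_cut_by (isT : (1 < r)%N) st (chain_model_type hz I).
have [fv fvP] := kept_contracts.
rewrite /tropical_vec (height_vec_contracts (fv := fv) _ cut fvP) /=.
apply: eq_bigr => j _; congr (_ *: _).
have [cj|cj] := ltP 0 (c j).
  have [j' j'E] := kept_nth_surj cj.
  rewrite (big_pred1 (s0, j')) => [|[s k]]; first by rewrite /kept_length j'E.
  by rewrite /= -j'E !xpair_eqE (inj_eq kept_nth_inj).
(* The coefficient vanishes here, and so would the length [c j] of any edge in the sum. *)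
rewrite big1 => [|e /eqP [_ ej]].
  by apply/eqP; rewrite eq_le cj c_ge0.
by apply/eqP; rewrite eq_le /kept_length ej cj c_ge0.
Qed.

End Realization.

(** * The bijection between tropical curves and the fan *)

Lemma cone_realized (R : realType) (r n : nat) (zeta : R[i]) (I : chain r n) v :
  (1 < r)%N -> r.-primitive_root zeta -> cone R I v ->
  exists t : tropical_curve r n zeta,
    T_chain I (tropical_class t) /\ tropical_vec t = v.
Proof.
case: r I v => [//|[//|r']] I v _ hz [c [c_ge0 ->]].
by exists (kept_tropical hz c); split; [apply: kept_T_chain|apply: kept_tropical_vec].
Qed.

(** The last clause makes the naturality precise: edge lengths along a spoke are the coefficients of
    the cone generators. *)
Theorem proposition5p2 (R : realType) (r n : nat) (zeta : R[i])
    (hr : (1 < r)%N) (hzeta : r.-primitive_root zeta) :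
  exists f : Ltrop r n zeta -> fan_space R r n,
    [/\ injective f,
        forall v, fan_support R r n v <-> exists c, f c = v,
        forall (I : chain r n) v,
          cone R I v <-> exists c, T_chain I c /\ f c = v
      & forall (t : tropical_curve r n zeta) (I : chain r n)
               (X : rn_curve R r n)
               (fv : vert (dual X) -> vert (tgraph t))
               (fe : edge (dual X) -> edge (tgraph t)) (s : 'I_r),
          in_Lbar zeta X -> has_type X I -> graph_iso fv fe ->
          f (tropical_class t)
          = \sum_(j < clen X) tlength (fe (s, j)) *: cone_gen R I j.+1].
Proof.
have /boolp.choice [f fE] : forall c : Ltrop r n zeta, exists v,
    exists t, c = tropical_class t /\ v = tropical_vec t.
  by case=> c [t E]; exists (tropical_vec t), t; split=> //; apply: eq_exist.
have f_class t : f (tropical_class t) = tropical_vec t.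
  have [t' [E ->]] := fE (tropical_class t).
  apply: tropical_vec_iso; apply: tropical_iso_sym.
  (* Equal classes are equal predicates; evaluating them at [t'], where the second holds by
     reflexivity, yields an isomorphism. *)
  have /(congr1 (fun h => h t')) /= -> : tropical_iso t = tropical_iso t'.
    exact (congr1 (@proj1_sig _ _) E).
  exact: tropical_iso_refl.
have class_surj (c : Ltrop r n zeta) : exists t, c = tropical_class t.
  by have [t [-> _]] := fE c; exists t.
have coneE (I : chain r n) v : cone R I v <-> exists c, T_chain I c /\ f c = v.
  split=> [/(cone_realized hr hzeta) [t [It <-]]|].
    by exists (tropical_class t).
  case=> _ [[t [X [-> XL type contr]]] <-]; rewrite f_class.
  exact (contraction_cone hr XL type contr).
exists f; split=> //.
- move=> c c'; have [t ->] := class_surj c; have [t' ->] := class_surj c'.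
  by rewrite !f_class => /(tropical_vec_inj hr)/tropical_class_eq.
- move=> v; split=> [[I _ /coneE [c [_ cv]]]|[c <-]]; first by exists c.
  by have [t ->] := class_surj c; rewrite f_class; apply: tropical_vec_support.
move=> t I X fv fe s [st _] type iso; rewrite f_class.
have [s0 cut] := type_cut_by hr st type.
exact (tropical_vec_type hr s st cut iso).
Qed.
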